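(* Every (discrete) amenable group, and every group in the class $\mathcal{C}$ of Linnell, has the algebraic eigenvalue property.
   Context: $\overline{\mathbb{Q}}$ is the field of algebraic numbers in $\mathbb{C}$. For a discrete group $G$, $l^2(G)=\{f\colon G\to\mathbb{C}\mid \sum_{g\in G}|f(g)|^2<\infty\}$, and a matrix $A\in M(d\times d,\mathbb{C}G)$ acts by left convolution as a bounded operator on $l^2(G)^d$. The group $G$ has the algebraic eigenvalue property if for every $d$ and every $A\in M(d\times d,\overline{\mathbb{Q}}G)$ the eigenvalues of $A$ acting on $l^2(G)^d$ are algebraic numbers. The class of elementary amenable groups is the smallest class of groups containing all cyclic and all finite groups and closed under group extensions and directed unions. $\mathcal{C}$ is the smallest class of groups containing all free groups and closed under extensions with elementary amenable quotient and under directed unions. *)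

(* Defs.v *)
From HB Require Import structures.
From mathcomp Require Import all_boot all_order all_algebra finmap.
From mathcomp Require Import complex ring lra.
From mathcomp Require Import all_classical all_reals all_analysis.

Set Implicit Arguments.
Unset Strict Implicit.
Unset Printing Implicit Defensive.

Import Order.TTheory GRing.Theory Num.Theory.
Import numFieldNormedType.Exports.

Local Open Scope classical_set_scope.
Local Open Scope ring_scope.

(** * Discrete groups *)

(** Exactness of [1 -> N -> G -> Q -> 1]. *)
Definition is_extension (N G Q : groupType) : Prop :=
  exists (i : {multiplicative N -> G}) (p : {multiplicative G -> Q}),
    [/\ injective i, (forall q, exists g, p g = q) &
        forall g, p g = 1%g <-> exists n, i n = g].

(** The subgroups forming the union are presented as the ranges of injective
    morphisms [H i -> G]. *)
Definition is_directed_union (G : groupType) (I : Type) (H : I -> groupType) :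
    Prop :=
  exists f : forall i, {multiplicative H i -> G},
    [/\ forall i, injective (f i),
        forall i j, exists k,
          range (f i) `<=` range (f k) /\ range (f j) `<=` range (f k) &
        \bigcup_i range (f i) = [set: G]].

Definition is_cyclic (G : groupType) : Prop :=
  exists g : G, forall x : G, exists n : nat, x = (g ^+ n)%g \/ x = (g ^- n)%g.

Definition is_finite_group (G : groupType) : Prop := finite_set [set: G].

(** [G] is free on some subset [S].  A map [S -> H] is given by an arbitrary
    map [G -> H], of which only the values on [S] matter. *)
Definition is_free_group (G : groupType) : Prop :=
  exists S : set G, forall (H : groupType) (u : G -> H),
    exists f : {multiplicative G -> H},
      (forall s, S s -> f s = u s) /\
      (forall f' : {multiplicative G -> H},
         (forall s, S s -> f' s = u s) -> forall g, f' g = f g).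

Inductive elementary_amenable : groupType -> Prop :=
| ea_cyclic (G : groupType) : is_cyclic G -> elementary_amenable G
| ea_finite (G : groupType) : is_finite_group G -> elementary_amenable G
| ea_extension (N G Q : groupType) :
    elementary_amenable N -> elementary_amenable Q -> is_extension N G Q ->
    elementary_amenable G
| ea_directed_union (G : groupType) (I : Type) (H : I -> groupType) :
    (forall i, elementary_amenable (H i)) -> is_directed_union G H ->
    elementary_amenable G.

Inductive linnell_class : groupType -> Prop :=
| linnell_free (G : groupType) : is_free_group G -> linnell_class G
| linnell_extension (N G Q : groupType) :
    linnell_class N -> elementary_amenable Q -> is_extension N G Q ->
    linnell_class G
| linnell_directed_union (G : groupType) (I : Type) (H : I -> groupType) :
    (forall i, linnell_class (H i)) -> is_directed_union G H ->
    linnell_class G.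

(** A left-invariant mean on the bounded real functions on [G]; the values of
    [m] at unbounded functions are irrelevant. *)
Definition is_invariant_mean (R : realType) (G : groupType)
    (m : (G -> R) -> R) : Prop :=
  [/\ forall (a : R) (f h : G -> R), bounded_fun f -> bounded_fun h ->
        m (fun x => a * f x + h x) = a * m f + m h,
      forall f : G -> R, bounded_fun f -> (forall x, 0 <= f x) -> 0 <= m f,
      m (fun=> 1) = 1 &
      forall (g : G) (f : G -> R), bounded_fun f ->
        m (fun x => f (g^-1 * x)%g) = m f].

Definition amenable (R : realType) (G : groupType) : Prop :=
  exists m : (G -> R) -> R, is_invariant_mean m.

(** * Group rings acting on square-summable functions *)

(** The complex group ring: finitely supported functions. *)
Definition group_ring (R : realType) (G : groupType) : Type :=
  {fsfun G -> R[i] with 0}.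

Definition l2 (R : realType) (G : groupType) : set (G -> R[i]) :=
  [set f | (\esum_(g in [set: G]) (Normc.normc (f g) ^+ 2)%:E < +oo)%E].

Definition convol (R : realType) (G : groupType) (a : group_ring R G)
    (f : G -> R[i]) : G -> R[i] :=
  fun x => \sum_(g <- finsupp a) a g * f (g^-1 * x)%g.

Definition mx_convol (R : realType) (G : groupType) (d : nat)
    (A : 'M[group_ring R G]_d) (v : 'I_d -> G -> R[i]) : 'I_d -> G -> R[i] :=
  fun i x => \sum_(j < d) convol (A i j) (v j) x.

(** The operator preserves [l2(G)^d]. *)
Section ConvolutionOnL2.
Variables (R : realType) (G : groupType).
Implicit Types f h : G -> R[i].

Lemma l2_0 : l2 (fun=> 0 : R[i]) (G := G).
Proof.
rewrite /l2 /= esum1 ?ltry// => g _.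
by rewrite [X in X ^+ 2](ComplexField.Normc.normc0 R) expr0n.
Qed.

Let normc_ge0 (z : R[i]) : 0 <= Normc.normc z.
Proof. by case: z => x y; exact: sqrtr_ge0. Qed.

Lemma l2D f h : l2 f -> l2 h -> l2 (fun x => f x + h x).
Proof.
rewrite /l2 /= => Hf Hh.
pose F g := (Normc.normc (f g) ^+ 2)%:E : \bar R.
pose H g := (Normc.normc (h g) ^+ 2)%:E : \bar R.
have F0 g : [set: G] g -> (0 <= F g)%E by rewrite lee_fin sqr_ge0.
have H0 g : [set: G] g -> (0 <= H g)%E by rewrite lee_fin sqr_ge0.
have FH0 g : [set: G] g -> (0 <= F g + H g)%E.
  by move=> _; rewrite adde_ge0 ?F0 ?H0.
apply: (@le_lt_trans _ _ (\esum_(g in [set: G]) ((F g + H g) + (F g + H g)))%E).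
  apply: le_esum => g _; rewrite -!EFinD lee_fin.
  have := le_normcD (f g) (h g).
  have := normc_ge0 (f g + h g).
  move: (Normc.normc _) => a.
  move: (Normc.normc (f g)) (Normc.normc (h g)) => b c a0 abc.
  apply: (@le_trans _ _ ((b + c) ^+ 2)); first by rewrite lerXn2r ?nnegrE// (le_trans a0).
  by have := sqr_ge0 (b - c); rewrite !expr2; nra.
rewrite esumD// esumD//.
by rewrite !lte_add_pinfty.
Qed.

Lemma l2Z (a : R[i]) f : l2 f -> l2 (fun x => a * f x).
Proof.
rewrite /l2 /= => Hf.
pose n := Num.bound (Normc.normc a ^+ 2).
pose F g := (Normc.normc (f g) ^+ 2)%:E : \bar R.
apply: (@le_lt_trans _ _ (\esum_(g in [set: G]) \sum_(j < n) F g)%E).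
  apply: le_esum => g _; rewrite sumEFin lee_fin sumr_const card_ord.
  rewrite [X in X ^+ 2]ComplexField.Normc.normcM exprMn -mulr_natl.
  by rewrite ler_wpM2r ?sqr_ge0// ltW// archi_boundP ?sqr_ge0.
rewrite esum_sum => [|g j _ _]; last by rewrite lee_fin sqr_ge0.
by apply/lte_sum_pinfty => j _.
Qed.

Lemma l2_translate (g : G) f : l2 f -> l2 (fun x => f (g^-1 * x)%g).
Proof.
rewrite /l2 /=; set F := fun x : G => (Normc.normc (f x) ^+ 2)%:E.
rewrite (@reindex_esum _ _ _ [set: G] [set: G] (fun x => (g^-1 * x)%g) F)//.
split=> // [x y _ _|x _]; first exact: mulgI.
by exists (g * x)%g; rewrite ?mulKg.
Qed.

Lemma l2_sum (I : Type) (r : seq I) (F : I -> G -> R[i]) :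
  (forall i, l2 (F i)) -> l2 (fun x => \sum_(i <- r) F i x).
Proof.
move=> HF; elim: r => [|i r IH].
  by under eq_fun do rewrite big_nil; exact: l2_0.
by under eq_fun do rewrite big_cons; exact: l2D.
Qed.

Lemma mx_convol_l2 (d : nat) (A : 'M[group_ring R G]_d)
    (v : 'I_d -> G -> R[i]) :
  (forall i, l2 (v i)) -> forall i, l2 (mx_convol A v i).
Proof.
move=> Hv i; apply: l2_sum => j; apply: l2_sum => g.
by apply: l2Z; apply: l2_translate.
Qed.

End ConvolutionOnL2.

(** Eigenvalues of the operator on [l2(G)^d]. *)
Definition l2_eigenvalue (R : realType) (G : groupType) (d : nat)
    (A : 'M[group_ring R G]_d) (lambda : R[i]) : Prop :=
  exists v : 'I_d -> G -> R[i],
    [/\ forall i, l2 (v i), exists i x, v i x != 0 &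
        forall i x, mx_convol A v i x = lambda * v i x].

Definition is_algebraic (R : realType) (z : R[i]) : Prop :=
  algebraicOver (ratr : rat -> R[i]) z.

Definition algebraic_eigenvalue_property (R : realType) (G : groupType) :
    Prop :=
  forall (d : nat) (A : 'M[group_ring R G]_d),
    (forall i j g, is_algebraic (A i j g)) ->
    forall lambda : R[i], l2_eigenvalue A lambda -> is_algebraic lambda.

(* Main.v *)
From HB Require Import structures.
From mathcomp Require Import all_boot all_order all_algebra finmap.
From mathcomp Require Import complex ring lra.
From mathcomp Require Import all_classical all_reals all_analysis.
Require Import Defs.

Set Implicit Arguments.
Unset Strict Implicit.
Unset Printing Implicit Defensive.

Import Order.TTheory GRing.Theory Num.Theory.
Import numFieldNormedType.Exports.

Local Open Scope classical_set_scope.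
Local Open Scope ring_scope.

(** Let [A] be a square matrix over the group ring of [G] whose coefficients
    are algebraic, and let [lambda] be an eigenvalue of [A] on l2.  Everything
    rests on a form of the rank theorem for the von Neumann dimension over a
    group [N] ([rank_inequality], [rank_convop]): if a matrix [B] over the real
    group ring of [N] maps l2(N)^I injectively into l2(N)^J, then what is
    orthogonal to its image has dimension at most |J| - |I|.  The proof needs
    neither projections nor completeness.  For small [c > 0] the operators
    [D = 1 - c B^T B] and [D' = 1 - c B B^T] are positive contractions; a
    vector [f] orthogonal to the image of [B] is fixed by [D'], so that
    [f(x)^2 <= |f|^2 * D'^(2n)(x, x)]; the traces of [D'^n] and [D^n] differ by
    |J| - |I|; and the trace of [D^n] tends to 0, because the vectors
    [D^n delta] converge pointwise to a square-summable vector of the kernel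
    of [B].  Complex vectors are split into real and imaginary parts.

    Extensions ([aep_folner_extension]).  Let [1 -> N -> G -> Q -> 1] be exact,
    where [N] has the property and [Q] has Folner sets.  If [lambda] is not
    algebraic, then over a finite subset [F] of [Q] with interior [F'], the
    transpose of [A - lambda] restricted to vectors supported above [F'] is
    injective: a vector in its kernel would give an eigenvector, for
    [lambda], of a matrix of size [d |F'|] over [N] with algebraic
    coefficients.  Its image lies above [F] and is orthogonal to the kernel
    of [A - lambda], and the rank inequality bounds the part of that kernel
    seen above [F] by a multiple of |F| - |F'|; but by translation invariance
    this part has size at least [theta^2 |F|] for some [theta <> 0], and a good
    Folner set gives a contradiction.

    Amenable groups.  By the theorem of Hahn and Banach, a group without
    Folner sets carries a bounded vector field of divergence at least
    [eps > 0] ([bounded_field]), and an invariant mean would give this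
    divergence the mean 0 ([amenable_folner]).  The extension theorem is then
    applied to the trivial subgroup, for which the eigenvalues are roots of a
    characteristic polynomial.

    The class of Linnell.  Directed unions are easy, since a matrix involves
    finitely many group elements, and an extension with elementary amenable
    quotient is handled by induction on the quotient, where only finite and
    cyclic groups need Folner sets.  For a free group, an operator that is
    injective on constant functions is injective on l2 ([free_injective]);
    hence an eigenvalue of [A] on l2 is already an eigenvalue of the finite
    matrix obtained by augmentation.  To see this, one first reduces to an
    operator that involves only generators.  If [v] is in its kernel, the rank
    inequality gives a vector [w] in the kernel of its transpose, and the
    matrix coefficients of [w] against [v] define an absolutely summable flow
    without sources on the Cayley graph.  This graph is a tree, so the flow
    vanishes; the resulting linear relation between the coordinates of [v]
    eliminates one unknown of the system. *)

(** * Sums of finitely supported functions *)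

Section FiniteSums.
Variables (R : realType) (N : choiceType).
Implicit Types (h : N -> R) (r : seq N).

Definition fsum h : R := \sum_(x \in [set: N]) h x.

Definition fin_supp h : Prop := exists r, forall x, x \notin r -> h x = 0.

Lemma fsumE r h : uniq r -> (forall x, x \notin r -> h x = 0) ->
  fsum h = \sum_(x <- r) h x.
Proof.
move=> Ur hr; rewrite /fsum (fsbigE r) //; last by move=> x _; exact: hr.
by apply: eq_bigl => x; rewrite in_setT.
Qed.

Lemma fin_supp_uniq h : fin_supp h ->
  exists2 r, uniq r & forall x, x \notin r -> h x = 0.
Proof.
by move=> [r hr]; exists (undup r); rewrite ?undup_uniq// => x; rewrite mem_undup; exact: hr.
Qed.

Lemma fin_supp0 : fin_supp (fun=> 0).
Proof. by exists [::]. Qed.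

Lemma fin_suppD h h' : fin_supp h -> fin_supp h' -> fin_supp (fun x => h x + h' x).
Proof.
move=> [r hr] [r' hr']; exists (r ++ r') => x.
by rewrite mem_cat negb_or => /andP[/hr-> /hr'->]; rewrite addr0.
Qed.

Lemma fin_suppMr h h' : fin_supp h -> fin_supp (fun x => h x * h' x).
Proof. by move=> [r hr]; exists r => x /hr ->; rewrite mul0r. Qed.

Lemma fin_suppMl h h' : fin_supp h -> fin_supp (fun x => h' x * h x).
Proof. by move=> [r hr]; exists r => x /hr ->; rewrite mulr0. Qed.

Lemma fin_supp_sum (K : Type) (s : seq K) (F : K -> N -> R) :
  (forall k, fin_supp (F k)) -> fin_supp (fun x => \sum_(k <- s) F k x).
Proof.
move=> Ff; elim: s => [|k s IH]; first by exists [::] => x; rewrite big_nil.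
have [r hr] := fin_suppD (Ff k) IH.
by exists r => x /hr; rewrite big_cons.
Qed.

Lemma fsumD h h' : fin_supp h -> fin_supp h' ->
  fsum (fun x => h x + h' x) = fsum h + fsum h'.
Proof.
move=> [r hr] [r' hr']; pose s := undup (r ++ r').
have hs x : x \notin s -> (h x = 0) /\ (h' x = 0).
  by rewrite mem_undup mem_cat negb_or => /andP[/hr-> /hr'->].
have E h0 : (forall x, x \notin s -> h0 x = 0) -> fsum h0 = \sum_(x <- s) h0 x.
  by apply: fsumE; exact: undup_uniq.
rewrite (E h) => [|x /hs[]//]; rewrite (E h') => [|x /hs[]//].
by rewrite -big_split; apply: E => x /hs [-> ->]; rewrite addr0.
Qed.

Lemma fsumZ a h : fsum (fun x => a * h x) = a * fsum h.
Proof. by rewrite /fsum mulr_fsumr. Qed.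

Lemma fsum0 : fsum (fun=> 0) = 0.
Proof. by rewrite (@fsumE [::]) ?big_nil. Qed.

Lemma eq_fsum h h' : h =1 h' -> fsum h = fsum h'.
Proof. by move=> /funext ->. Qed.

Lemma fsum_sum (K : Type) (s : seq K) (F : K -> N -> R) :
  (forall k, fin_supp (F k)) ->
  fsum (fun x => \sum_(k <- s) F k x) = \sum_(k <- s) fsum (F k).
Proof.
move=> Ff; elim: s => [|k s IH].
  by rewrite big_nil -[RHS]fsum0; apply: eq_fsum => x; rewrite big_nil.
rewrite big_cons -IH -fsumD //; last exact: fin_supp_sum.
by apply: eq_fsum => x; rewrite big_cons.
Qed.

Lemma fsum_ge0 h : (forall x, 0 <= h x) -> 0 <= fsum h.
Proof. by move=> h0; apply: fsumr_ge0 => x _; exact: h0. Qed.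

Lemma le_fsum h h' : fin_supp h -> fin_supp h' -> (forall x, h x <= h' x) ->
  fsum h <= fsum h'.
Proof.
move=> fh fh' hh'.
have fd : fin_supp (fun x => -1 * h x) by exact: fin_suppMl.
have : 0 <= fsum (fun x => h' x + -1 * h x).
  by apply: fsum_ge0 => x; rewrite mulN1r subr_ge0.
by rewrite fsumD // fsumZ mulN1r subr_ge0.
Qed.

Lemma fsum_bij (f f' : N -> N) h : cancel f f' -> cancel f' f ->
  fsum (fun x => h (f x)) = fsum h.
Proof.
by move=> ff' f'f; apply/esym/reindex_fsbigT; exists f'.
Qed.

End FiniteSums.

(** * Adjoint pairs of operators and their traces *)

Section Vectors.
Variables (R : realType) (N : groupType).

Definition vec (I : finType) := I -> N -> R.

Definition lincomb (I : finType) (a : R) (u v : vec I) : vec I :=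
  fun i x => a * u i x + v i x.

Definition delta (I : finType) (i0 : I) (x0 : N) : vec I :=
  fun i x => ((i == i0) && (x == x0))%:R.

Definition finite_vec (I : finType) (u : vec I) : Prop := forall i, fin_supp (u i).

Definition dotp (I : finType) (u f : vec I) : R :=
  \sum_i fsum (fun x => u i x * f i x).

Definition l2_le (I : finType) (u : vec I) (C : R) : Prop :=
  forall r : seq N, uniq r -> \sum_i \sum_(x <- r) u i x ^+ 2 <= C.

Section OneIndex.
Variable I : finType.
Implicit Types u v f : vec I.

Lemma finite_vec_delta i x : finite_vec (@delta I i x).
Proof.
move=> j; exists [:: x] => y; rewrite inE => /negPf yx.
by rewrite /delta yx andbF.
Qed.

Lemma finite_vec_lincomb a u v : finite_vec u -> finite_vec v -> finite_vec (lincomb a u v).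
Proof. by move=> fu fv i; apply: fin_suppD => //; exact: fin_suppMl. Qed.

Lemma dotpC u f : dotp u f = dotp f u.
Proof. by apply: eq_bigr => i _; apply: eq_fsum => x; rewrite mulrC. Qed.

Lemma dotp_lincomb a u v f : finite_vec u -> finite_vec v -> dotp (lincomb a u v) f = a * dotp u f + dotp v f.
Proof.
move=> fu fv; rewrite /dotp mulr_sumr -big_split; apply: eq_bigr => i _ /=.
rewrite -fsumZ -fsumD; last exact: fin_suppMr.
  by apply: eq_fsum => x; rewrite /lincomb mulrDl mulrA.
by apply/fin_suppMl/fin_suppMr.
Qed.

Lemma dotp_delta i x f : dotp (delta i x) f = f i x.
Proof.
rewrite /dotp (bigD1 i) //= big1 => [|j /negPf ji]; last first.
  by rewrite -[RHS](@fsum0 R N); apply: eq_fsum => y; rewrite /delta ji mul0r.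
rewrite addr0 (@fsumE _ _ [:: x]) // => [|y]; first by rewrite big_seq1 /delta !eqxx mul1r.
by rewrite inE /delta => /negPf->; rewrite andbF mul0r.
Qed.

Lemma dotp_ge0 u : 0 <= dotp u u.
Proof. by apply: sumr_ge0 => i _; apply: fsum_ge0 => x; rewrite -expr2 sqr_ge0. Qed.

Lemma finite_vec_uniq u : finite_vec u ->
  exists2 r, uniq r & forall i x, x \notin r -> u i x = 0.
Proof.
move=> fu; pose r i := sval (cid (fu i)).
have hr i x : x \notin r i -> u i x = 0 by exact: (svalP (cid (fu i))).
exists (undup (flatten [seq r i | i <- enum I])); first exact: undup_uniq.
move=> i x; rewrite mem_undup => xr; apply: hr; apply: contra xr => xr.
by apply/flattenP; exists (r i) => //; apply/map_f; rewrite mem_enum.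
Qed.

Lemma dotpE r u f : uniq r -> (forall i x, x \notin r -> u i x = 0) ->
  dotp u f = \sum_i \sum_(x <- r) u i x * f i x.
Proof.
move=> Ur ur; apply: eq_bigr => i _; rewrite (fsumE Ur) // => x xr.
by rewrite ur ?mul0r.
Qed.

Lemma l2_le_finite_vec u : finite_vec u -> l2_le u (dotp u u).
Proof.
move=> /finite_vec_uniq[r Ur ur] s Us; apply: ler_sum => i _.
pose t := undup (s ++ r).
rewrite (@fsumE _ _ t) ?undup_uniq // => [|x]; last first.
  by rewrite mem_undup mem_cat negb_or => /andP[_ /ur->]; rewrite mul0r.
have {1}-> : s = [seq x <- s | true] by rewrite filter_predT.
rewrite (perm_big [seq x <- t | x \in s]); last first.
  rewrite filter_predT; apply: uniq_perm => //; first by rewrite filter_uniq ?undup_uniq.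
  by move=> x; rewrite mem_filter mem_undup mem_cat; case: (x \in s).
rewrite big_filter big_mkcond; apply: ler_sum => x _.
by case: ifP => _; [rewrite expr2 | rewrite -expr2 sqr_ge0].
Qed.

Lemma le_sqr_dotp u i x : finite_vec u -> u i x ^+ 2 <= dotp u u.
Proof.
move=> fu; have := @l2_le_finite_vec u fu [:: x] isT.
rewrite (bigD1 i) //= big_seq1; apply: le_trans; rewrite lerDl.
by apply: sumr_ge0 => j _; apply: sumr_ge0 => y _; rewrite sqr_ge0.
Qed.

(** Cauchy-Schwarz for a finitely supported vector against a square-summable
    one: it only involves the restriction of the latter to the support of the
    former. *)
Lemma dotp_sqr_le u f C : finite_vec u -> l2_le f C -> dotp u f ^+ 2 <= C * dotp u u.
Proof.
move=> fu fC; have [r Ur ur] := finite_vec_uniq fu.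
have C0 : 0 <= C.
  by apply: le_trans (fC [::] isT); apply: sumr_ge0 => i _; rewrite big_nil.
have := fC r Ur; rewrite !(dotpE _ Ur ur) => hC.
set X := \sum_i _; set F := \sum_i _ in hC; set U := \sum_i _.
(* nonnegativity of the norm of [a u - b f] on the support of [u] *)
have key (a b : R) : 0 <= a ^+ 2 * U - 2 * a * b * X + b ^+ 2 * F.
  have -> : a ^+ 2 * U - 2 * a * b * X + b ^+ 2 * F =
      \sum_i \sum_(x <- r) (a * u i x - b * f i x) ^+ 2.
    rewrite /U /X /F !mulr_sumr -sumrB -big_split; apply: eq_bigr => i _ /=.
    rewrite !mulr_sumr -sumrB -big_split; apply: eq_bigr => x _ /=.
    by rewrite !expr2; ring.
  by apply: sumr_ge0 => i _; apply: sumr_ge0 => x _; rewrite sqr_ge0.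
have U0 : 0 <= U.
  by apply: sumr_ge0 => i _; apply: sumr_ge0 => x _; rewrite -expr2 sqr_ge0.
have [U_eq0|Un0] := eqVneq U 0.
  suff -> : X = 0 by rewrite expr2 mul0r U_eq0 mulr0.
  apply/eqP; apply: contraT => X0; have := key ((F + 1) / (2 * X)) 1.
  rewrite U_eq0 mulr0 (_ : _ + _ = -1) ?oppr_ge0 ?ler10 //.
  by field.
have Upos : 0 < U by rewrite lt0r Un0.
have := key X U; rewrite !expr2 => h.
have : 0 <= U * (U * F - X * X) by nra.
rewrite pmulr_rge0 // subr_ge0 => /le_trans; apply.
by rewrite mulrC ler_wpM2r.
Qed.

End OneIndex.

(** The operators for which a trace is defined without convergence: mutually
    transpose, commuting with right translations and preserving finite
    supports. *)
Record adjoint_pair (I J : finType) (P : vec I -> vec J) (Pt : vec J -> vec I) : Prop :=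
  AdjointPair {
    op_lin : forall a u v, P (lincomb a u v) = lincomb a (P u) (P v);
    op_lint : forall a u v, Pt (lincomb a u v) = lincomb a (Pt u) (Pt v);
    op_finite_vec : forall u, finite_vec u -> finite_vec (P u);
    op_fst : forall u, finite_vec u -> finite_vec (Pt u);
    op_adj : forall u f, finite_vec u -> dotp (P u) f = dotp u (Pt f);
    op_adjt : forall u f, finite_vec u -> dotp (Pt u) f = dotp u (P f);
    op_trans : forall n u, P (fun i x => u i (x * n)%g) = (fun j x => P u j (x * n)%g);
    op_transt : forall n u, Pt (fun i x => u i (x * n)%g) = (fun j x => Pt u j (x * n)%g)
  }.

Lemma adjoint_pair_sym (I J : finType) P Pt : @adjoint_pair I J P Pt -> adjoint_pair Pt P.
Proof. by case. Qed.

Lemma adjoint_pair_comp (I J K : finType) P Pt Q Qt : @adjoint_pair I J P Pt -> @adjoint_pair J K Q Qt ->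
  adjoint_pair (Q \o P) (Pt \o Qt).
Proof.
case=> l1 l1' f1 f1' a1 a1' t1 t1' [l2 l2' f2 f2' a2 a2' t2 t2'].
split=> /= [a u v|a u v|u fu|u fu|u f fu|u f fu|n u|n u].
- by rewrite l1 l2.
- by rewrite l2' l1'.
- exact/f2/f1.
- exact/f1'/f2'.
- by rewrite a2 ?a1//; exact: f1.
- by rewrite a1' ?a2'//; exact: f2'.
- by rewrite t1 t2.
- by rewrite t2' t1'.
Qed.

Lemma adjoint_pair_id (I : finType) : adjoint_pair (@id (vec I)) id.
Proof. by []. Qed.

Lemma adjoint_pair_iter (I : finType) (P : vec I -> vec I) n :
  adjoint_pair P P -> adjoint_pair (iter n P) (iter n P).
Proof.
move=> oP; elim: n => [|n IH]; first exact: adjoint_pair_id.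
have := adjoint_pair_comp oP IH.
have -> : iter n P \o P = iter n.+1 P by apply/funext => u /=; rewrite -iterSr.
by [].
Qed.

Lemma adjoint_pair_1sub (I : finType) (P : vec I -> vec I) (c : R) :
  adjoint_pair P P -> adjoint_pair (fun u => lincomb c (P u) u) (fun u => lincomb c (P u) u).
Proof.
case=> l _ f _ a _ t _.
have L b u v : lincomb c (P (lincomb b u v)) (lincomb b u v) = lincomb b (lincomb c (P u) u) (lincomb c (P v) v).
  by rewrite l; apply/funext => i; apply/funext => x; rewrite /lincomb; ring.
have A u g : finite_vec u -> dotp (lincomb c (P u) u) g = dotp u (lincomb c (P g) g).
  move=> fu; rewrite dotp_lincomb // ?a //; last exact: f.
  rewrite /dotp mulr_sumr -big_split; apply: eq_bigr => i _ /=.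
  rewrite -fsumZ -fsumD; [|exact/fin_suppMl/fin_suppMr/fu|exact/fin_suppMr/fu].
  by apply: eq_fsum => x; rewrite /lincomb; ring.
have T n u : lincomb c (P (fun i x => u i (x * n)%g)) (fun i x => u i (x * n)%g) =
    (fun j x => lincomb c (P u) u j (x * n)%g) by rewrite t.
by split=> // u fu; apply: finite_vec_lincomb => //; exact: f.
Qed.

(** Translating both arguments of the matrix entry between [(i, x)] and
    [(j, 1)] by the inverse of [x] moves the first one to [(i, 1)]. *)
Lemma adjoint_pair_flip (I J : finType) P Pt : @adjoint_pair I J P Pt ->
  forall i j x, Pt (delta j 1%g) i x = P (delta i 1%g) j x^-1%g.
Proof.
move=> oP i j x.
rewrite -(dotp_delta j x^-1%g) dotpC -/(dotp _ _) (op_adj oP); last exact: finite_vec_delta.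
rewrite dotp_delta.
have -> : delta j x^-1%g = (fun k y => delta j 1%g k (y * x)%g).
  by apply/funext => k; apply/funext => y; rewrite /delta -mulg_eq1.
by rewrite (op_transt oP) mul1g.
Qed.

(** The von Neumann trace: diagonal entries over one point of each orbit. *)
Definition trace (I : finType) (P : vec I -> vec I) : R := \sum_i P (delta i 1%g) i 1%g.

(** Both traces are the sum over [i], [j] and [x] of the entry of [Q] from
    [(j, 1)] to [(i, x)] times the entry of [P] back; by invariance the entry
    of either operator may be based at [i] instead of [j], with [x] inverted. *)
Lemma trace_cyclic (I J : finType) P Pt Q Qt :
  @adjoint_pair I J P Pt -> @adjoint_pair J I Q Qt -> trace (P \o Q) = trace (Q \o P).
Proof.
move=> oP oQ; rewrite /trace /=.
transitivity (\sum_j dotp (Q (delta j 1%g)) (Pt (delta j 1%g))).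
  apply: eq_bigr => j _; rewrite -(op_adj oP); last exact/(op_finite_vec oQ)/finite_vec_delta.
  by rewrite dotpC dotp_delta.
transitivity (\sum_i dotp (Qt (delta i 1%g)) (P (delta i 1%g))); last first.
  apply: eq_bigr => i _; rewrite (op_adjt oQ); last exact: finite_vec_delta.
  by rewrite dotp_delta.
rewrite /dotp exchange_big; apply: eq_bigr => i _; apply: eq_bigr => j _ /=.
rewrite -(fsum_bij _ (@invgK N) (@invgK N)); apply: eq_fsum => x.
by rewrite (adjoint_pair_flip oP) (adjoint_pair_flip (adjoint_pair_sym oQ)) !invgK.
Qed.

End Vectors.
Arguments delta {R N I} i0 x0.

(** * The rank inequality *)

Lemma cvg_ge_id (f : nat -> nat) : (forall n, (n <= f n)%N) -> f @ \oo --> \oo.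
Proof.
move=> nf; apply/cvgnyPge => k; near=> n.
by apply: leq_trans (nf n); near: n; exact: nbhs_infty_ge.
Unshelve. all: by end_near.
Qed.

Lemma cvg_sumr (R : realType) (K : Type) (s : seq K) (F : K -> nat -> R) (l : K -> R) :
  (forall k, true -> F k @ \oo --> l k) ->
  (fun n => \sum_(k <- s) F k n) @ \oo --> \sum_(k <- s) l k.
Proof. by move=> Fl; apply: cvg_big => //; exact: add_continuous. Qed.

Section RankInequality.
Variables (R : realType) (N : groupType) (I J : finType).
Notation vec := (vec R N).
Variables (B : vec I -> vec J) (Bt : vec J -> vec I) (c : R).
Hypothesis oB : adjoint_pair B Bt.
Hypothesis c_gt0 : 0 < c.
Hypothesis Bt_le : forall w, finite_vec w -> c * dotp (Bt w) (Bt w) <= dotp w w.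
Hypothesis B_cvg : forall (u : nat -> vec I) (v : vec I),
  (forall i x, (fun n => u n i x) @ \oo --> v i x) ->
  forall j x, (fun n => B (u n) j x) @ \oo --> B v j x.
Hypothesis B_inj : forall u C, l2_le u C -> B u = (fun _ _ => 0) -> u = (fun _ _ => 0).

(** The operators [D = 1 - c B^T B] and [D' = 1 - c B B^T] of the introduction,
    positive contractions for the constants [c] allowed here. *)
Definition shrink (u : vec I) : vec I := lincomb (- c) (Bt (B u)) u.
Definition coshrink (w : vec J) : vec J := lincomb (- c) (B (Bt w)) w.

Lemma adjoint_pair_shrink : adjoint_pair shrink shrink.
Proof. exact: (adjoint_pair_1sub (- c) (adjoint_pair_comp oB (adjoint_pair_sym oB))). Qed.

Lemma adjoint_pair_coshrink : adjoint_pair coshrink coshrink.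
Proof. exact: (adjoint_pair_1sub (- c) (adjoint_pair_comp (adjoint_pair_sym oB) oB)). Qed.

Lemma dotp_shrink u : finite_vec u -> dotp (shrink u) u = dotp u u - c * dotp (B u) (B u).
Proof.
move=> fu; rewrite dotp_lincomb //; last exact/(op_fst oB)/(op_finite_vec oB).
by rewrite (op_adjt oB) ?mulNr 1?addrC //; exact: (op_finite_vec oB).
Qed.

(** [D^2 <= D]; since [D - D^2 = c B^T (1 - c B B^T) B], this is where the bound
    on [B^T] is used. *)
Lemma dotp_shrink2 u : finite_vec u -> dotp (shrink u) (shrink u) <= dotp (shrink u) u.
Proof.
move=> fu; have fBu := op_finite_vec oB fu; have fBBu := op_fst oB fBu.
have fDu : finite_vec (shrink u) by exact: (op_finite_vec adjoint_pair_shrink).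
have E : dotp (shrink u) (shrink u) =
    dotp u u - 2 * c * dotp (B u) (B u) + c * (c * dotp (Bt (B u)) (Bt (B u))).
  have -> : dotp (shrink u) (shrink u) = - c * dotp (Bt (B u)) (shrink u) + dotp u (shrink u).
    by rewrite {1}/shrink dotp_lincomb.
  rewrite [dotp u _]dotpC dotp_shrink // [dotp _ (shrink u)]dotpC {1}/shrink dotp_lincomb //.
  have -> : dotp u (Bt (B u)) = dotp (B u) (B u) by rewrite dotpC (op_adjt oB).
  by ring.
rewrite E dotp_shrink //.
have := ler_wpM2l (ltW c_gt0) (Bt_le fBu); lra.
Qed.

Section Moments.
Variable z : vec I.
Hypothesis fz : finite_vec z.

Definition moment n := dotp (iter n shrink z) z.

Lemma finite_vec_iter n : finite_vec (iter n shrink z).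
Proof. exact: (op_finite_vec (adjoint_pair_iter n adjoint_pair_shrink)). Qed.

Lemma momentD m n : dotp (iter m shrink z) (iter n shrink z) = moment (m + n).
Proof.
rewrite /moment addnC iterD [RHS](op_adj (adjoint_pair_iter n adjoint_pair_shrink)) //.
exact: finite_vec_iter.
Qed.

(** Even moments are squared norms, and [D^2 <= D] bounds an odd moment below
    by the next even one. *)
Lemma moment_ge0 n : 0 <= moment n.
Proof.
have even k : 0 <= moment (k + k) by rewrite -momentD dotp_ge0.
have := odd_double_half n; case: (odd n) => <-; last by rewrite add0n -addnn.
rewrite add1n -addnn; set k := n./2.
apply: le_trans (even k.+1) _; rewrite -momentD iterS.
by apply: le_trans (dotp_shrink2 (finite_vec_iter k)) _; rewrite -iterS momentD addSn.
Qed.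

Lemma moment_le n : moment n.+1 <= moment n.
Proof.
have := odd_double_half n; case: (odd n) => <-; set k := n./2.
  rewrite add1n -addnn -addSn -addnS -momentD iterS.
  by apply: le_trans (dotp_shrink2 (finite_vec_iter k)) _; rewrite -iterS momentD addSn.
rewrite add0n -addnn -addSn -!momentD iterS dotp_shrink ?gerBl; last exact: finite_vec_iter.
by rewrite mulr_ge0 ?dotp_ge0 // ltW.
Qed.

Lemma moment_cvg : cvgn moment.
Proof.
apply: nonincreasing_is_cvgn; last by exists 0 => _ [n _ <-]; exact: moment_ge0.
by apply/nonincreasing_seqP; exact: moment_le.
Qed.

End Moments.

Lemma moment_lincombE z w n : finite_vec z -> finite_vec w ->
  moment (lincomb 1 z w) n = moment z n + moment w n + 2 * dotp (iter n shrink z) w.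
Proof.
move=> fz fw; have oD := adjoint_pair_iter n adjoint_pair_shrink.
have fzw := finite_vec_lincomb 1 fz fw; have := op_finite_vec oD fzw.
rewrite /moment (op_lin oD) => fD.
have fDz := op_finite_vec oD fz; have fDw := op_finite_vec oD fw.
rewrite dotp_lincomb // ![dotp _ (lincomb 1 z w)]dotpC !dotp_lincomb //.
rewrite [dotp z (iter n shrink z)]dotpC [dotp w (iter n shrink w)]dotpC.
rewrite [dotp w (iter n shrink z)]dotpC.
have -> : dotp z (iter n shrink w) = dotp (iter n shrink z) w by rewrite (op_adj oD).
ring.
Qed.

(** By polarization the entries of [D^n] are combinations of moments, which
    are monotone. *)
Lemma iter_shrink_cvg z i x : finite_vec z -> cvgn (fun n => iter n shrink z i x).
Proof.
move=> fz; have fd := @finite_vec_delta R N I i x.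
have -> : (fun n => iter n shrink z i x) = (fun n => 2^-1 *
    (moment (lincomb 1 z (delta i x)) n - moment z n - moment (delta i x) n)).
  apply/funext => n; rewrite moment_lincombE // -[LHS](dotp_delta i x) dotpC; lra.
apply: is_cvgM; first exact: is_cvg_cst.
by apply: is_cvgB; [apply: is_cvgB|]; apply: moment_cvg => //; exact: finite_vec_lincomb.
Qed.

(** The pointwise limit [u] of [D^n z] is square-summable, and it is killed by
    [B]: [c] times the squared norm of [B D^n z] is the difference of two
    consecutive moments.  As [B] is injective, [u] vanishes. *)
Lemma moment_cvg0 z : finite_vec z -> moment z @ \oo --> 0.
Proof.
move=> fz; pose u i x := limn (fun n => iter n shrink z i x).
have cu i x : (fun n => iter n shrink z i x) @ \oo --> u i x by exact: iter_shrink_cvg.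
have mle n : moment z n <= moment z 0.
  elim: n => // n; exact: le_trans (moment_le fz n).
have l2u : l2_le u (moment z 0).
  move=> r Ur.
  have cs : (fun n => \sum_i \sum_(x <- r) iter n shrink z i x ^+ 2) @ \oo -->
      \sum_i \sum_(x <- r) u i x ^+ 2.
    by apply: cvg_sumr => i _; apply: cvg_sumr => x _; rewrite expr2; apply: cvgM.
  rewrite -(cvg_lim (@Rhausdorff R) cs); apply: limr_le; first by apply: cvgP cs.
  apply: nearW => n; apply: le_trans (l2_le_finite_vec (finite_vec_iter fz n) Ur) _.
  by rewrite momentD.
have Bu0 : B u = (fun _ _ => 0).
  apply/funext => j; apply/funext => x.
  have cB : (fun n => B (iter n shrink z) j x) @ \oo --> B u j x by exact: B_cvg.
  have c0 : (fun n => c * (B (iter n shrink z) j x) ^+ 2) @ \oo --> 0.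
    have dm : (fun n => moment z (n + n) - moment z (n + n).+1) @ \oo --> 0.
      have /cvg_ex[l ml] := moment_cvg fz.
      have dbl : (fun n => (n + n)%N) @ \oo --> \oo.
        by apply: cvg_ge_id => n; rewrite ?leq_addr // leqW ?leq_addr.
      rewrite -(subrr l); apply: cvgB; first exact: cvg_comp dbl ml.
      have dblS : (fun n => (n + n).+1) @ \oo --> \oo.
        by apply: cvg_ge_id => n; rewrite ?leq_addr // leqW ?leq_addr.
      exact: cvg_comp dblS ml.
    apply: (squeeze_cvgr _ (cvg_cst 0) dm); apply: nearW => n.
    rewrite mulr_ge0 ?sqr_ge0 ?(ltW c_gt0) //=.
    have fBn : finite_vec (B (iter n shrink z)) by apply/(op_finite_vec oB)/finite_vec_iter.
    rewrite -addSn -!momentD // iterS dotp_shrink; last exact: finite_vec_iter.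
    rewrite opprB addrC subrK ler_pM2l //; exact: le_sqr_dotp.
  have c1 : (fun n => c * (B (iter n shrink z) j x) ^+ 2) @ \oo --> c * (B u j x * B u j x).
    by apply: cvgM; [exact: cvg_cst | exact: cvgM].
  have : c * (B u j x * B u j x) = 0 by exact: (cvg_unique (@Rhausdorff R) c1 c0).
  move=> /eqP; by rewrite mulf_eq0 mulf_eq0 orbb gt_eqF //= => /eqP.
have u0 := B_inj l2u Bu0.
have [r Ur zr] := finite_vec_uniq fz.
have -> : moment z = (fun n => \sum_i \sum_(x <- r) z i x * iter n shrink z i x).
  by apply/funext => n; rewrite /moment dotpC (dotpE _ Ur zr).
have cv : (fun n => \sum_i \sum_(x <- r) z i x * iter n shrink z i x) @ \oo -->
    \sum_i \sum_(x <- r) z i x * u i x.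
  apply: cvg_sumr => i _; apply: cvg_sumr => x _.
  by apply: cvgM; [exact: cvg_cst | exact: cu].
rewrite big1 // in cv => i _; by rewrite big1 // => x _; rewrite u0 mulr0.
Unshelve. all: by end_near.
Qed.

(** Since [D' B = B D], passing from [n] to [n + 1] subtracts [c tr (B D^n B^T)]
    on one side and [c tr (D^n B^T B)] on the other. *)
Lemma trace_shrink n :
  trace (iter n coshrink) - #|J|%:R = trace (iter n shrink) - #|I|%:R.
Proof.
have T0 (K : finType) : trace (@id (vec K)) = #|K|%:R.
  rewrite /trace (eq_bigr (fun=> 1)) ?sumr_const // => i _.
  by rewrite /delta !eqxx.
elim: n => [|n IH]; first by rewrite !T0 !subrr.
have BD u : iter n coshrink (B u) = B (iter n shrink u).
  elim: n {IH} => //= n ->.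
  by rewrite /shrink /coshrink (op_lin oB).
have oD := adjoint_pair_iter n adjoint_pair_shrink.
have tr1 : trace (iter n.+1 coshrink) =
    trace (iter n coshrink) - c * trace (B \o (iter n shrink \o Bt)).
  rewrite /trace mulr_sumr -sumrB; apply: eq_bigr => j _.
  rewrite iterSr {2}/coshrink (op_lin (adjoint_pair_iter n adjoint_pair_coshrink)) /lincomb BD /=.
  by rewrite mulNr addrC.
have tr2 : trace (iter n.+1 shrink) =
    trace (iter n shrink) - c * trace ((iter n shrink \o Bt) \o B).
  rewrite /trace mulr_sumr -sumrB; apply: eq_bigr => j _.
  rewrite iterSr {2}/shrink (op_lin oD) /lincomb /=.
  by rewrite mulNr addrC.
rewrite tr1 tr2 (trace_cyclic oB (adjoint_pair_comp (adjoint_pair_sym oB) oD)).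
by rewrite addrAC IH addrAC.
Qed.

(** A vector orthogonal to the image of [B] is fixed by [D'], so its value at a
    point is bounded by the norm of the column of [D'^n] at that point.  Summed
    over [J], the squares of these norms give the trace of [D'^(2n)]. *)
Lemma rank_inequality (f : J -> vec J) :
  (forall j, l2_le (f j) 1) -> (forall j, Bt (f j) = (fun _ _ => 0)) ->
  \sum_j f j j 1%g ^+ 2 <= #|J|%:R - #|I|%:R.
Proof.
move=> f1 Bf.
have fixf j n : iter n coshrink (f j) = f j.
  elim: n => //= n ->; apply/funext => k; apply/funext => x.
  rewrite /coshrink /lincomb Bf.
  have -> : B (fun _ _ => 0) = (fun _ _ => 0).
    have -> : (fun _ _ => 0) = lincomb (-1) (fun _ _ => 0) (fun _ _ => 0) :> vec I.
      by apply/funext => ?; apply/funext => ?; rewrite /lincomb mulr0 addr0.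
    rewrite (op_lin oB); apply/funext => ?; apply/funext => ?.
    by rewrite /lincomb mulN1r addNr.
  by rewrite mulr0 add0r.
have le_n n : \sum_j f j j 1%g ^+ 2 <=
    #|J|%:R - #|I|%:R + \sum_i moment (delta i 1%g) (n + n).
  have -> : \sum_i moment (delta i 1%g) (n + n) = trace (iter (n + n) shrink).
    by apply: eq_bigr => i _; rewrite /moment dotpC dotp_delta.
  apply: (@le_trans _ _ (trace (iter (n + n) coshrink))); last first.
    have := trace_shrink (n + n); lra.
  apply: ler_sum => j _; have fd := @finite_vec_delta R N J j 1%g.
  have oD := adjoint_pair_iter n adjoint_pair_coshrink.
  have -> : f j j 1%g = dotp (iter n coshrink (delta j 1%g)) (f j).
    by rewrite (op_adj oD) // fixf dotp_delta.
  have -> : iter (n + n) coshrink (delta j 1%g) j 1%g =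
      dotp (iter n coshrink (delta j 1%g)) (iter n coshrink (delta j 1%g)).
    by rewrite iterD -[LHS](dotp_delta j 1%g) -(op_adj oD).
  apply: le_trans (dotp_sqr_le (op_finite_vec oD fd) (f1 j)) _; by rewrite mul1r.
have cv : (fun n => #|J|%:R - #|I|%:R + \sum_i moment (delta i 1%g) (n + n)) @ \oo -->
    #|J|%:R - #|I|%:R + \sum_(i : I) (0 : R).
  apply: cvgD; first exact: cvg_cst.
  apply: cvg_sumr => i _.
  have dbl : (fun n => (n + n)%N) @ \oo --> \oo.
    by apply: cvg_ge_id => n; rewrite ?leq_addr // leqW ?leq_addr.
  exact: cvg_comp dbl (moment_cvg0 (@finite_vec_delta R N I i 1%g)).
rewrite big1 // addr0 in cv.
rewrite -(cvg_lim (@Rhausdorff R) cv); apply: limr_ge; first by apply: cvgP cv.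
exact: nearW.
Unshelve. all: by end_near.
Qed.

End RankInequality.

(** * Convolution by matrices over the group ring *)

Lemma sqr_sum_le (R : realType) (K : Type) (s : seq K) (z : K -> R) :
  (\sum_(k <- s) z k) ^+ 2 <= (size s)%:R * \sum_(k <- s) z k ^+ 2.
Proof.
elim: s => [|k s IH]; first by rewrite !big_nil expr2 !mul0r.
rewrite !big_cons /=; set S := \sum_(_ <- s) z _; set Q := \sum_(_ <- s) _.
have Q0 : 0 <= Q by apply: sumr_ge0 => ? _; rewrite sqr_ge0.
move: IH; rewrite -/S -/Q -natr1.
have [->|n0] := eqVneq (size s) 0%N.
  rewrite mul0r add0r => S0; have /eqP : S ^+ 2 = 0 by apply/eqP; rewrite eq_le S0 sqr_ge0.
  by rewrite sqrf_eq0 => /eqP ->; rewrite addr0 mul1r lerDl.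
have : 0 < (size s)%:R :> R by rewrite ltr0n lt0n.
move: (size s)%:R (z k) => n z0 npos SQ.
have : 0 <= n * (n * z0 ^+ 2 + Q - 2 * z0 * S).
  have := sqr_ge0 (n * z0 - S); rewrite !expr2 in SQ *; nra.
rewrite pmulr_rge0 //; rewrite !expr2 in SQ *; nra.
Qed.

Section GroupRingOperators.
Variable G : groupType.

Definition convop (K : nzRingType) (I J : finType) (T : seq G) (M : G -> J -> I -> K)
    (v : I -> G -> K) : J -> G -> K :=
  fun j x => \sum_(g <- T) \sum_i M g j i * v i (g^-1 * x)%g.

Definition inv_seq (T : seq G) : seq G := [seq g^-1%g | g <- T].
Definition transp (K : Type) (I J : Type) (M : G -> J -> I -> K) : G -> I -> J -> K :=
  fun g i j => M g^-1%g j i.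

Lemma convop_tr (K : nzRingType) (I J : finType) (T : seq G) (M : G -> J -> I -> K) w i x :
  convop (inv_seq T) (transp M) w i x = \sum_(g <- T) \sum_j M g j i * w j (g * x)%g.
Proof.
rewrite /convop big_map; apply: eq_bigr => g _; apply: eq_bigr => j _.
by rewrite /transp !invgK.
Qed.

Lemma inv_seqK : involutive inv_seq.
Proof. by move=> T; rewrite /inv_seq -map_comp map_id_in // => g _ /=; rewrite invgK. Qed.

Lemma transpK (K I J : Type) (M : G -> J -> I -> K) : transp (transp M) = M.
Proof. by apply/funext => g; rewrite /transp invgK. Qed.

Lemma convop_rtrans (K : nzRingType) (I J : finType) (T : seq G) (M : G -> J -> I -> K) n v :
  convop T M (fun i x => v i (x * n)%g) = (fun j x => convop T M v j (x * n)%g).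
Proof.
apply/funext => j; apply/funext => x; apply: eq_bigr => g _.
by apply: eq_bigr => i _; rewrite mulgA.
Qed.

Variable R : realType.

Section RealOperator.
Variables (I J : finType) (T : seq G) (M : G -> J -> I -> R).

Lemma convop_lin a u v : convop T M (lincomb a u v) = lincomb a (convop T M u) (convop T M v).
Proof.
apply/funext => j; apply/funext => x; rewrite /lincomb /convop mulr_sumr -big_split.
apply: eq_bigr => g _; rewrite mulr_sumr -big_split; apply: eq_bigr => i _ /=.
ring.
Qed.

Lemma fin_supp_trans g (h : G -> R) : fin_supp h -> fin_supp (fun x => h (g^-1 * x)%g).
Proof.
move=> [r hr]; exists [seq (g * y)%g | y <- r] => x xr; apply: hr.
by apply: contra xr => xr; apply/mapP; exists (g^-1 * x)%g; rewrite ?mulVKg.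
Qed.

Lemma convop_finite_vec u : finite_vec u -> finite_vec (convop T M u).
Proof.
move=> fu j; apply: fin_supp_sum => g; apply: fin_supp_sum => i.
exact/fin_suppMl/fin_supp_trans.
Qed.

Lemma convop_adj u f : finite_vec u -> dotp (convop T M u) f = dotp u (convop (inv_seq T) (transp M) f).
Proof.
move=> fu.
transitivity (\sum_j \sum_(g <- T) \sum_i
    M g j i * fsum (fun x => u i (g^-1 * x)%g * f j x)).
  apply: eq_bigr => j _.
  transitivity (fsum (fun x => \sum_(g <- T) \sum_i
      M g j i * (u i (g^-1 * x)%g * f j x))).
    apply: eq_fsum => x; rewrite mulr_suml; apply: eq_bigr => g _.
    by rewrite mulr_suml; apply: eq_bigr => i _; rewrite mulrA.
  have fF g i : fin_supp (fun x => M g j i * (u i (g^-1 * x)%g * f j x)).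
    by apply/fin_suppMl/fin_suppMr/fin_supp_trans.
  rewrite fsum_sum => [|g]; last exact: fin_supp_sum.
  by apply: eq_bigr => g _; rewrite fsum_sum //; apply: eq_bigr => i _; rewrite fsumZ.
transitivity (\sum_i \sum_(g <- T) \sum_j
    M g j i * fsum (fun x => u i x * f j (g * x)%g)); last first.
  apply: eq_bigr => i _.
  have fF g j : fin_supp (fun x => M g j i * (u i x * f j (g * x)%g)).
    exact/fin_suppMl/fin_suppMr.
  transitivity (fsum (fun x => \sum_(g <- T) \sum_j
      M g j i * (u i x * f j (g * x)%g))); last first.
    apply: eq_fsum => x; rewrite convop_tr mulr_sumr; apply: eq_bigr => g _.
    by rewrite mulr_sumr; apply: eq_bigr => j _; rewrite mulrCA.
  rewrite fsum_sum => [|g]; last exact: fin_supp_sum.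
  by apply: eq_bigr => g _; rewrite fsum_sum //; apply: eq_bigr => j _; rewrite fsumZ.
rewrite exchange_big [RHS]exchange_big; apply: eq_bigr => g _ /=.
rewrite exchange_big; apply: eq_bigr => i _; apply: eq_bigr => j _; congr (_ * _).
rewrite -(fsum_bij (fun x => u i (g^-1 * x)%g * f j x) (mulKg g) (mulVKg g)).
by apply: eq_fsum => x; rewrite mulKg.
Qed.

Lemma convop_bounded : exists2 C, 0 < C & forall u, finite_vec u ->
  dotp (convop T M u) (convop T M u) <= C * dotp u u.
Proof.
pose k : R := (size T)%:R * #|I|%:R.
pose m : R := \sum_j \sum_(g <- T) \sum_i M g j i ^+ 2.
have m0 : 0 <= m.
  by do 3![apply: sumr_ge0 => ? _]; rewrite sqr_ge0.
have k0 : 0 <= k by rewrite mulr_ge0 ?ler0n.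
exists (k * m + 1); first by rewrite ltr_wpDl ?ltr01 ?mulr_ge0.
move=> u fu; rewrite mulrDl mul1r ler_wpDr ?dotp_ge0 //.
rewrite -mulrA [m * _]mulr_suml mulr_sumr; apply: ler_sum => j _.
have fsq (g : G) i : fin_supp (fun x => (M g j i * u i (g^-1 * x)%g) ^+ 2).
  exact/fin_suppMl/fin_suppMl/fin_supp_trans.
have fsq2 : fin_supp (fun x => \sum_(g <- T) \sum_i (M g j i * u i (g^-1 * x)%g) ^+ 2).
  by do 2![apply: fin_supp_sum => ?].
apply: (@le_trans _ _ (fsum (fun x => k *
    \sum_(g <- T) \sum_i (M g j i * u i (g^-1 * x)%g) ^+ 2))).
  apply: le_fsum.
  - by apply: fin_suppMr; exact: convop_finite_vec.
  - exact: fin_suppMl.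
  - move=> x; rewrite -expr2; apply: le_trans (sqr_sum_le _ _) _.
    rewrite /k -mulrA; apply: ler_wpM2l; first exact: ler0n.
    rewrite mulr_sumr; apply: ler_sum => g _.
    by apply: le_trans (sqr_sum_le _ _) _; rewrite cardT enumT.
rewrite fsumZ; apply: ler_wpM2l => //.
rewrite fsum_sum => [|g]; last exact: fin_supp_sum.
rewrite mulr_suml; apply: ler_sum => g _; rewrite fsum_sum // mulr_suml.
apply: ler_sum => i _.
rewrite (@eq_fsum _ _ _ (fun x => M g j i ^+ 2 * (u i (g^-1 * x)%g * u i (g^-1 * x)%g))).
  rewrite fsumZ; apply: ler_wpM2l; first exact: sqr_ge0.
  rewrite (fsum_bij (fun x => u i x * u i x) (mulVKg g) (mulKg g)).
  rewrite /dotp (bigD1 i) //= lerDl; apply: sumr_ge0 => i' _.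
  by apply: fsum_ge0 => x; rewrite -expr2 sqr_ge0.
by move=> x; rewrite exprMn expr2.
Qed.

Lemma convop_cvg (u : nat -> vec R G I) (v : vec R G I) :
  (forall i x, (fun n => u n i x) @ \oo --> v i x) ->
  forall j x, (fun n => convop T M (u n) j x) @ \oo --> convop T M v j x.
Proof.
move=> uv j x; apply: cvg_sumr => g _; apply: cvg_sumr => i _.
by apply: cvgM; [exact: cvg_cst | exact: uv].
Qed.

End RealOperator.

Lemma adjoint_pair_convop (I J : finType) T (M : G -> J -> I -> R) :
  adjoint_pair (convop T M) (convop (inv_seq T) (transp M)).
Proof.
split=> *; rewrite ?convop_lin ?convop_adj ?convop_rtrans //; try exact: convop_finite_vec.
by rewrite inv_seqK transpK.
Qed.

(** The rank inequality for matrices over the real group ring: they are bounded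
    and their kernels are closed under pointwise limits. *)
Theorem rank_convop (I J : finType) T (M : G -> J -> I -> R) (f : J -> vec R G J) :
  (forall u C, l2_le u C -> convop T M u = (fun _ _ => 0) -> u = (fun _ _ => 0)) ->
  (forall j, l2_le (f j) 1) ->
  (forall j, convop (inv_seq T) (transp M) (f j) = (fun _ _ => 0)) ->
  \sum_j f j j 1%g ^+ 2 <= #|J|%:R - #|I|%:R.
Proof.
move=> Minj f1 f0.
have [C C0 CP] := convop_bounded (inv_seq T) (transp M).
apply: (@rank_inequality _ _ _ _ (convop T M) (convop (inv_seq T) (transp M)) C^-1) => //.
- exact: adjoint_pair_convop.
- by rewrite invr_gt0.
- by move=> u fu; rewrite ler_pdivrMl //; exact: CP.
- exact: convop_cvg.
Qed.

End GroupRingOperators.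

(** * Square-summable vectors in real coordinates *)

Section SquareSummable.
Variables (R : realType) (G : groupType).

Lemma l2_le_scale (I : finType) (a : R) (u : vec R G I) C :
  l2_le u C -> l2_le (fun i x => a * u i x) (a ^+ 2 * C).
Proof.
move=> uC r Ur; apply: le_trans (ler_wpM2l (sqr_ge0 a) (uC r Ur)).
rewrite mulr_sumr le_eqVlt; apply/orP; left; apply/eqP; apply: eq_bigr => i _.
by rewrite mulr_sumr; apply: eq_bigr => x _; rewrite exprMn.
Qed.

(** Covers translations as well as restrictions to unions of cosets. *)
Lemma l2_le_inj (H : groupType) (I J : finType) (u : vec R G I) C (p : J -> H -> I * G) :
  (forall j j' x x', p j x = p j' x' -> j = j' /\ x = x') ->
  l2_le u C -> l2_le (fun j x => u (p j x).1 (p j x).2) C.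
Proof.
move=> pinj uC r Ur.
pose q (jx : J * H) := p jx.1 jx.2.
pose s := [seq (j, x) | j <- enum J, x <- r].
have Us : uniq s.
  by apply: allpairs_uniq; [exact: enum_uniq | exact: Ur | move=> [? ?] [? ?] _ _].
have Uq : uniq (map q s).
  by rewrite map_inj_uniq // => -[j x] [j' x'] /pinj [/= -> ->].
pose t := undup (map snd (map q s)).
apply: le_trans (uC t (undup_uniq _)).
have -> : \sum_j \sum_(x <- r) u (p j x).1 (p j x).2 ^+ 2 =
    \sum_(y <- map q s) u y.1 y.2 ^+ 2.
  by rewrite big_map big_allpairs_dep /= big_enum.
pose w := [seq (i, y) | i <- enum I, y <- t].
have Uw : uniq w.
  by apply: allpairs_uniq; [exact: enum_uniq | exact: undup_uniq | move=> [? ?] [? ?] _ _].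
have -> : \sum_i \sum_(y <- t) u i y ^+ 2 = \sum_(y <- w) u y.1 y.2 ^+ 2.
  by rewrite big_allpairs_dep /= big_enum.
have sub : {subset map q s <= w}.
  move=> [i y] yq; apply/allpairsP; exists (i, y); split=> //=; first by rewrite mem_enum.
  by rewrite mem_undup; apply/mapP; exists (i, y).
rewrite (perm_big [seq y <- w | y \in map q s]); last first.
  apply: uniq_perm => //; first exact: filter_uniq.
  by move=> y; rewrite mem_filter; case: (boolP (y \in map q s)) => //= /sub ->.
rewrite big_filter big_mkcond; apply: ler_sum => y _.
by case: ifP => _ //; exact: sqr_ge0.
Qed.

Lemma l2_le_ge0 (I : finType) (u : vec R G I) C : l2_le u C -> 0 <= C.
Proof. by move=> /(_ [::] isT); apply: le_trans; apply: sumr_ge0 => i _; rewrite big_nil. Qed.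

Lemma l2_le_rtrans (I : finType) (u : vec R G I) C n :
  l2_le u C -> l2_le (fun i x => u i (x * n)%g) C.
Proof.
apply: (l2_le_inj (p := fun i x => (i, (x * n)%g))) => i i' x x' [-> /mulIg ->].
by [].
Qed.

(** For [w] in the kernel of the transpose, all the translates of a multiple of
    [w] are orthogonal to the image of the operator; if the latter were
    injective, the rank inequality would make their values vanish. *)
Lemma kernel_transpose (I J : finType) T (M : G -> J -> I -> R) (w : vec R G J) C :
  (#|J| <= #|I|)%N ->
  l2_le w C -> convop (inv_seq T) (transp M) w = (fun _ _ => 0) -> w <> (fun _ _ => 0) ->
  exists u C', [/\ l2_le u C', convop T M u = (fun _ _ => 0) & u <> (fun _ _ => 0)].
Proof.
move=> leJI wC Mw w0; apply: contrapT => noker; apply: w0.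
have C0 := l2_le_ge0 wC; pose a := (C + 1)^-1.
have C1 : 0 < C + 1 by rewrite ltr_wpDl.
apply/funext => j; apply/funext => x0.
have : \sum_j (a * w j (1 * x0)%g) ^+ 2 <= #|J|%:R - #|I|%:R.
  apply: (@rank_convop G R I J T M (fun _ i x => a * w i (x * x0)%g)).
- move=> u C' uC' Mu; apply: contrapT => u0; apply: noker; by exists u, C'.
- move=> _ r Ur; apply: le_trans (l2_le_scale a (l2_le_rtrans x0 wC) Ur) _.
  by rewrite /a exprVn mulrC ler_pdivrMr ?exprn_gt0 // mul1r expr2; nra.
- move=> _; have -> : (fun i x => a * w i (x * x0)%g) =
      lincomb (a - 1) (fun i x => w i (x * x0)%g) (fun i x => w i (x * x0)%g).
    by apply/funext => i; apply/funext => x; rewrite /lincomb; ring.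
  rewrite convop_lin convop_rtrans Mw; apply/funext => i; apply/funext => x.
  by rewrite /lincomb mulr0 addr0.
move=> le0.
have {}le0 : \sum_j (a * w j (1 * x0)%g) ^+ 2 <= 0.
  by apply: le_trans le0 _; rewrite subr_le0 ler_nat.
have : \sum_j (a * w j (1 * x0)%g) ^+ 2 == 0.
  by rewrite eq_le le0 sumr_ge0 // => i _; exact: sqr_ge0.
rewrite psumr_eq0 => [/allP /(_ j (mem_index_enum j))|i _]; last exact: sqr_ge0.
rewrite /= sqrf_eq0 mulf_eq0 invr_eq0 gt_eqF //= mul1g => /eqP.
by [].
Qed.

End SquareSummable.

Section ComplexToReal.
Variables (R : realType) (G : groupType).
Notation C := R[i].

Definition realify (I : finType) (v : I -> G -> C) : vec R G (I * bool)%type :=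
  fun ib x => if ib.2 then complex.Im (v ib.1 x) else complex.Re (v ib.1 x).

Definition complexify (I : finType) (u : vec R G (I * bool)%type) : I -> G -> C :=
  fun i x => Complex (u (i, false) x) (u (i, true) x).

(** A complex number acts on pairs of reals by its 2 by 2 matrix; the index
    [true] stands for the imaginary part. *)
Definition real_coef (I J : finType) (M : G -> J -> I -> C) :
    G -> (J * bool)%type -> (I * bool)%type -> R :=
  fun g jb ib => let z := M g jb.1 ib.1 in
    if jb.2 == ib.2 then complex.Re z
    else if jb.2 then complex.Im z else - complex.Im z.

Definition conj_coef (I J : finType) (M : G -> J -> I -> C) : G -> J -> I -> C :=
  fun g j i => conjc (M g j i).

Lemma realifyK I : cancel (@realify I) (@complexify I).
Proof. by move=> v; apply/funext => i; apply/funext => x; rewrite /complexify /realify /=; case: (v i x). Qed.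

Lemma complexifyK I : cancel (@complexify I) (@realify I).
Proof. by move=> u; apply/funext => -[i []]; apply/funext => x. Qed.

Lemma realify0 I : @realify I (fun _ _ => 0) = (fun _ _ => 0).
Proof. by apply/funext => -[i []]; apply/funext. Qed.

Lemma Re_sum (K : Type) (s : seq K) (F : K -> C) :
  complex.Re (\sum_(k <- s) F k) = \sum_(k <- s) complex.Re (F k).
Proof. by apply: (big_morph (@complex.Re R)) => // -[a b] [c d]. Qed.

Lemma Im_sum (K : Type) (s : seq K) (F : K -> C) :
  complex.Im (\sum_(k <- s) F k) = \sum_(k <- s) complex.Im (F k).
Proof. by apply: (big_morph (@complex.Im R)) => // -[a b] [c d]. Qed.

Lemma convop_realify (I J : finType) T (M : G -> J -> I -> C) v :
  convop T (real_coef M) (realify v) = realify (convop T M v).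
Proof.
apply/funext => -[j b]; apply/funext => x.
transitivity (\sum_(g <- T) \sum_i \sum_(b' : bool)
    real_coef M g (j, b) (i, b') * realify v (i, b') (g^-1 * x)%g).
  apply: eq_bigr => g _.
  rewrite (pair_bigA _ (fun i b' => real_coef M g (j, b) (i, b') * realify v (i, b') (g^-1 * x)%g)).
  by apply: eq_bigr => -[].
rewrite /realify /convop /=.
under eq_bigr => g _ do under eq_bigr => i _ do rewrite big_bool /=.
case: b; rewrite ?Re_sum ?Im_sum; apply: eq_bigr => g _;
  rewrite ?Re_sum ?Im_sum; apply: eq_bigr => i _; rewrite /real_coef /=;
  case: (M g j i) => a b; case: (v i _) => c d /=; ring.
Qed.

Lemma transp_real_coef (I J : finType) (M : G -> J -> I -> C) :
  transp (real_coef M) = real_coef (conj_coef (transp M)).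
Proof.
apply/funext => g; apply/funext => -[i b]; apply/funext => -[j b'].
rewrite /transp /real_coef /conj_coef /=; case: (M _ j i) => x y /=.
by case: b; case: b' => //=; rewrite opprK.
Qed.

Lemma normc_sqr (z : C) : Normc.normc z ^+ 2 = complex.Re z ^+ 2 + complex.Im z ^+ 2.
Proof. by case: z => a b; rewrite /= sqr_sqrtr // addr_ge0 ?sqr_ge0. Qed.

Lemma l2P (f : G -> C) : l2 f <->
  exists K, forall r, uniq r -> \sum_(x <- r) Normc.normc (f x) ^+ 2 <= K.
Proof.
have pos x : (0 <= (Normc.normc (f x) ^+ 2)%:E)%E by rewrite lee_fin sqr_ge0.
split=> [fl2|[K fK]].
  have fin : (\esum_(g in [set: G]) (Normc.normc (f g) ^+ 2)%:E)%E \is a fin_num.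
    by rewrite ge0_fin_numE //; apply: esum_ge0 => x _.
  exists (fine (\esum_(g in [set: G]) (Normc.normc (f g) ^+ 2)%:E)%E) => r Ur.
  rewrite -lee_fin fineK // -sumEFin fsbig_seq //; apply: esum_ge.
  by exists [set` r]; first by split; [exact: finite_seq|].
rewrite /l2 /=; apply: (@le_lt_trans _ _ K%:E); last exact: ltry.
apply: ub_ereal_sup => _ [A [finA _] <-].
rewrite fsbig_finite //= sumEFin lee_fin; apply: fK.
exact: fset_uniq.
Qed.

Lemma l2_l2_le (I : finType) (v : I -> G -> C) : (forall i, l2 (v i)) ->
  exists K, l2_le (realify v) K.
Proof.
move=> vl; pose K i := sval (cid ((l2P (v i)).1 (vl i))).
have KP i r : uniq r -> \sum_(x <- r) Normc.normc (v i x) ^+ 2 <= K i.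
  exact: (svalP (cid ((l2P (v i)).1 (vl i)))).
exists (\sum_i K i) => r Ur.
rewrite -(pair_bigA _ (fun i b => \sum_(x <- r) realify v (i, b) x ^+ 2)) /=.
apply: ler_sum => i _; rewrite big_bool /= -big_split.
apply: le_trans (KP i r Ur); apply: ler_sum => x _.
by rewrite normc_sqr addrC.
Qed.

Lemma l2_le_l2 (I : finType) (v : I -> G -> C) K : l2_le (realify v) K -> forall i, l2 (v i).
Proof.
move=> vK i; apply/l2P; exists K => r Ur; apply: le_trans (vK r Ur).
rewrite -(pair_bigA _ (fun i b => \sum_(x <- r) realify v (i, b) x ^+ 2)) /=.
rewrite (bigD1 i) //= -[leLHS]addr0; apply: lerD; last first.
  apply: sumr_ge0 => j _; apply: sumr_ge0 => b _; apply: sumr_ge0 => x _.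
  exact: sqr_ge0.
rewrite big_bool /= -big_split; apply: ler_sum => x _.
by rewrite normc_sqr addrC.
Qed.

End ComplexToReal.

(** * Eigenvalues of matrices of algebraic numbers *)

Lemma big_uniq_sub (K : nzRingType) (T : eqType) (r s : seq T) (F : T -> K) :
  uniq r -> uniq s -> {subset r <= s} -> (forall x, x \notin r -> F x = 0) ->
  \sum_(x <- s) F x = \sum_(x <- r) F x.
Proof.
move=> Ur Us rs F0; rewrite [RHS](perm_big [seq x <- s | x \in r]); last first.
  apply: uniq_perm => //; first exact: filter_uniq.
  move=> x; rewrite mem_filter; apply/idP/andP => [xr|[]//].
  by split=> //; exact: rs.
rewrite big_filter [RHS]big_mkcond; apply: eq_bigr => x _.
by case: ifP => // /negbT xr; rewrite F0.
Qed.

Lemma big_ord_enum (K : nmodType) (I : finType) (F : I -> K) :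
  \sum_i F i = \sum_(a < #|I|) F (enum_val a).
Proof. by rewrite -big_enum_val; apply: eq_bigl. Qed.

Section AlgebraicNumbers.
Variable R : realType.
Notation C := R[i].
Notation alg := (@is_algebraic R).

Lemma alg_sum (K : Type) (s : seq K) (P : pred K) (F : K -> C) :
  (forall k, alg (F k)) -> alg (\sum_(k <- s | P k) F k).
Proof.
move=> Fa; elim/big_rec: _ => [|k x _ xa]; first exact: algebraic0.
exact: (algebraic_add (Fa k) xa).
Qed.

(** The characteristic polynomial is monic with algebraic coefficients, and
    the algebraic numbers are integrally closed. *)
Lemma alg_eigenvalue_mx n (A : 'M[C]_n) lambda :
  (forall i j, alg (A i j)) -> eigenvalue A lambda -> alg lambda.
Proof.
move=> Aa; rewrite eigenvalue_root_char => lam.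
pose polyalg (p : {poly C}) := forall k, alg p`_k.
have aC c : alg c -> polyalg c%:P.
  by move=> ca k; rewrite coefC; case: eqP => // _; exact: algebraic0.
have aN p : polyalg p -> polyalg (- p).
  by move=> pa k; rewrite coefN; exact: (algebraic_opp (pa k)).
have aM p q : polyalg p -> polyalg q -> polyalg (p * q).
  move=> pa qa k; rewrite coefM; apply: alg_sum => i; exact: (algebraic_mul (pa _) (qa _)).
have aD p q : polyalg p -> polyalg q -> polyalg (p + q).
  by move=> pa qa k; rewrite coefD; exact: (algebraic_add (pa k) (qa k)).
have aX : polyalg 'X by move=> k; rewrite coefX; case: eqP => _; [exact: algebraic1 | exact: algebraic0].
have a1 : polyalg 1 by apply: aC; exact: algebraic1.
have a0 : polyalg 0 by apply: aC; exact: algebraic0.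
have aS (b : bool) : polyalg ((-1) ^+ b).
  by case: b; [rewrite expr1; apply: (aN); apply: (a1) | rewrite expr0; apply: (a1)].
have ca : polyalg (char_poly A).
  rewrite /char_poly /determinant; elim/big_rec: _ => // s q _ qa; apply: (aD) => //.
  apply: (aM); first exact: aS.
  apply: (big_ind polyalg) => [|p r|i _]; [exact: a1 | exact: aM |].
  rewrite !mxE.
  apply: aD; last by apply/aN/aC.
  by case: (_ == _); rewrite ?mulr1n ?mulr0n.
apply/integral_algebraic; apply: integral_root_monic (char_poly_monic A) lam _.
by apply/integral_poly => i; apply/integral_algebraic; exact: ca.
Qed.

Lemma alg_eigenvalue (I : finType) (M : I -> I -> C) (r : I -> C) lambda :
  (forall i j, alg (M i j)) -> (exists i, r i != 0) ->
  (forall i, \sum_j M i j * r j = lambda * r i) -> alg lambda.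
Proof.
move=> Ma [i0 ri0] Mr.
pose A := \matrix_(a < #|I|, b < #|I|) M (enum_val b) (enum_val a).
apply: (@alg_eigenvalue_mx _ A) => [a b|]; first by rewrite mxE.
apply/eigenvalueP; exists (\row_a r (enum_val a)).
  apply/rowP => a; rewrite !mxE -Mr.
  rewrite [RHS]big_ord_enum; apply: eq_bigr => b _.
  by rewrite !mxE mulrC.
apply: contra ri0 => /eqP /rowP /(_ (enum_rank i0)).
by rewrite !mxE enum_rankK => ->.
Qed.

End AlgebraicNumbers.

(** * The eigenvalue property and subgroups *)

Section EigenvalueProperty.
Variable R : realType.
Notation C := R[i].
Notation alg := (@is_algebraic R).
Notation AEP := (@algebraic_eigenvalue_property R).

Lemma convolE (G : groupType) (a : group_ring R G) (T : seq G) f x :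
  uniq T -> {subset finsupp a <= T} ->
  convol a f x = \sum_(g <- T) a g * f (g^-1 * x)%g.
Proof.
move=> UT aT; rewrite /convol; apply/esym/big_uniq_sub => // [|g ga].
  exact: fset_uniq.
by rewrite fsfun_dflt ?mul0r.
Qed.

(** The form in which the property is used: matrices are indexed by an
    arbitrary finite type and given by their coefficients. *)
Lemma aep_convop (G : groupType) : AEP G ->
  forall (I : finType) T (M : G -> I -> I -> C) (v : I -> G -> C) lambda,
  uniq T -> (forall g i j, alg (M g i j)) -> (forall i, l2 (v i)) ->
  (exists i x, v i x != 0) ->
  (forall i x, convop T M v i x = lambda * v i x) -> alg lambda.
Proof.
move=> aepG I T M v lambda UT Ma vl2 [i0 [x0 v0]] Mv.
pose a i j : group_ring R G := [fsfun g in seq_fset tt T => M g i j | 0 : C].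
have aE i j g : a i j g = if g \in T then M g i j else 0.
  by rewrite /a fsfunE seq_fsetE.
pose A : 'M[group_ring R G]_(#|I|) := \matrix_(k, l) a (enum_val k) (enum_val l).
apply: (aepG _ A).
  by move=> k l g; rewrite mxE aE; case: ifP => _ //; exact: algebraic0.
exists (fun k => v (enum_val k)); split=> //.
  by exists (enum_rank i0), x0; rewrite enum_rankK.
move=> k x; rewrite -Mv /mx_convol /convop exchange_big /= [RHS]big_ord_enum.
apply: eq_bigr => l _; rewrite mxE (@convolE _ _ T) // => [|g].
  rewrite big_seq [RHS]big_seq; apply: eq_bigr => g gT; by rewrite aE gT.
by rewrite mem_finsupp aE; case: ifP => //; rewrite eqxx.
Qed.

Lemma group_ring_mx_supp (G : groupType) d (A : 'M[group_ring R G]_d) :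
  exists T : seq G, uniq T /\ forall g, g \notin T -> forall i j, A i j g = 0.
Proof.
pose T := undup (flatten [seq finsupp (A ij.1 ij.2) : seq G | ij <- enum {: 'I_d * 'I_d}]).
exists T; split=> [|g gT i j]; first exact: undup_uniq.
apply: fsfun_dflt; apply: contra gT => gA; rewrite mem_undup; apply/flattenP.
exists (finsupp (A i j) : seq G) => //; apply/mapP; exists (i, j) => //.
by rewrite mem_enum.
Qed.

Lemma mx_convolE (G : groupType) d (A : 'M[group_ring R G]_d) T v :
  uniq T -> (forall g, g \notin T -> forall i j, A i j g = 0) ->
  mx_convol A v = convop T (fun g i j => A i j g) v.
Proof.
move=> UT A0; apply/funext => i; apply/funext => x.
rewrite /convop exchange_big; apply: eq_bigr => j _; rewrite (convolE _ _ UT) // => g.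
by apply: contraTT => /A0 Ag; rewrite mem_finsupp Ag eqxx.
Qed.

Lemma morph_1 (G H : groupType) (f : {multiplicative G -> H}) : f 1%g = 1%g.
Proof. by apply: (mulgI (f 1%g)); rewrite -gmulfM !mulg1. Qed.

Lemma morph_V (G H : groupType) (f : {multiplicative G -> H}) x : f x^-1%g = (f x)^-1%g.
Proof. by apply: (mulgI (f x)); rewrite -gmulfM !mulgV morph_1. Qed.

(** Left convolution by elements of the subgroup preserves each of its right
    cosets, so the eigenvector restricts to an eigenvector on the coset of
    a point where it does not vanish. *)
Lemma aep_restrict (G H : groupType) (f : {multiplicative H -> G}) d
    (A : 'M[group_ring R G]_d) lambda :
  injective f -> AEP H -> (forall i j g, alg (A i j g)) ->
  (forall i j g, A i j g != 0 -> exists h, f h = g) ->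
  l2_eigenvalue A lambda -> alg lambda.
Proof.
move=> finj aepH Aalg Af [v [vl2 [i0 [x0 v0]] Av]].
have [T [UT A0]] := group_ring_mx_supp A.
pose S := undup (pmap (fun g => if pselect (exists h, f h = g) is left ex
  then Some (sval (cid ex)) else None) T).
have fS h : f h \in T -> h \in S.
  move=> fT; rewrite mem_undup mem_pmap; apply/mapP; exists (f h) => //.
  by case: pselect => [ex|[]]; [rewrite (finj _ _ (svalP (cid ex))) | exists h].
have Sf h : h \in S -> f h \in T.
  rewrite mem_undup mem_pmap => /mapP[g gT]; case: pselect => // ex [->].
  by rewrite (svalP (cid ex)).
apply: (aep_convop aepH (T := S) (M := fun h i j => A i j (f h))
  (v := fun i h => v i (f h * x0)%g)) => //.
- exact: undup_uniq.
- move=> i; have /l2P[K vK] := vl2 i; apply/l2P; exists K => r Ur.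
  have := vK [seq (f h * x0)%g | h <- r].
  rewrite map_inj_uniq => [/(_ Ur)|h h' /mulIg /finj //]; by rewrite big_map.
- by exists i0, 1%g; rewrite morph_1 mul1g.
- move=> i h; rewrite -Av (mx_convolE _ UT A0) /convop.
  rewrite (@big_uniq_sub _ _ [seq f h | h <- S] T).
  + rewrite big_map; apply: eq_bigr => k _; apply: eq_bigr => j _.
    by rewrite gmulfM morph_V mulgA.
  + by rewrite map_inj_uniq // undup_uniq.
  + by [].
  + by move=> _ /mapP[k kS ->]; exact: Sf.
  + move=> g gS; rewrite big1 // => j _.
    have [->|/Af[k fk]] := eqVneq (A i j g) 0; first by rewrite mul0r.
    rewrite A0 ?mul0r //; apply: contra gS; rewrite -fk => /fS kS.
    exact: map_f.
Qed.

Lemma directed_seq (G : groupType) (I : Type) (H : I -> groupType)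
    (f : forall i, {multiplicative H i -> G}) :
  (forall i j, exists k, range (f i) `<=` range (f k) /\ range (f j) `<=` range (f k)) ->
  \bigcup_i range (f i) = [set: G] ->
  forall T : seq G, exists k, forall g, g \in T -> range (f k) g.
Proof.
move=> dir cov; have cov1 g : exists k, range (f k) g.
  have : (\bigcup_i range (f i)) g by rewrite cov.
  by move=> [k _ ?]; exists k.
elim=> [|g T [k kT]]; first by have [k _] := cov1 1%g; exists k.
have [l lg] := cov1 g; have [m [km lm]] := dir k l.
exists m => h; rewrite inE => /predU1P[->|/kT]; [exact: lm|exact: km].
Qed.

Lemma aep_directed_union (G : groupType) (I : Type) (H : I -> groupType) :
  (forall i, AEP (H i)) -> is_directed_union G H -> AEP G.
Proof.
move=> aepH [f [finj dir cov]] d A Aalg lambda.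
have [T [UT A0]] := group_ring_mx_supp A.
have [k kT] := directed_seq dir cov T.
apply: (aep_restrict (finj k) (aepH k) Aalg) => i j g Ag.
have /kT[h _ fh] : g \in T by apply: contraNT Ag => /A0 ->; rewrite eqxx.
by exists h.
Qed.

Lemma aep_trivial (G : groupType) : (forall g : G, g = 1%g) -> AEP G.
Proof.
move=> G1 d A Aalg lambda [v [vl2 [i0 [x0 v0]] Av]].
apply: (@alg_eigenvalue R 'I_d (fun i j => A i j 1%g) (fun i => v i 1%g)) => //.
  by exists i0; rewrite -(G1 x0).
move=> i; rewrite -Av (@mx_convolE _ _ _ [:: 1%g]) //.
  by rewrite /convop big_seq1 invg1 mulg1.
by move=> g; rewrite (G1 g) inE eqxx.
Qed.

End EigenvalueProperty.

(** * Extensions with a Folner quotient *)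

Section FolnerExtension.
Variable R : realType.
Notation C := R[i].
Notation alg := (@is_algebraic R).
Notation AEP := (@algebraic_eigenvalue_property R).

(** Folner's condition, for left translations. *)
Definition folner (Q : groupType) : Prop :=
  forall (E : seq Q) (eps : R), 0 < eps -> exists F : seq Q,
    [/\ uniq F, (0 < size F)%N &
      (count (fun q => ~~ all (fun e => (e * q)%g \in F) E) F)%:R <= eps * (size F)%:R].

Lemma convop_conj (G : groupType) (I J : finType) T (M : G -> J -> I -> C) v :
  convop T (conj_coef M) (fun i x => conjc (v i x)) = (fun j x => conjc (convop T M v j x)).
Proof.
apply/funext => j; apply/funext => x; rewrite /convop rmorph_sum; apply: eq_bigr => g _.
by rewrite rmorph_sum; apply: eq_bigr => i _; rewrite rmorphM.
Qed.

(** The coefficients of [A - lambda], where the rows of [A] may be indexed by a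
    part of its columns, embedded by [iota]. *)
Definition sub_coef (G : groupType) (I J : finType) (iota : J -> I) (lambda : C)
    (M : G -> J -> I -> C) : G -> J -> I -> C :=
  fun g j i => M g j i - ((g == 1%g) && (iota j == i))%:R * lambda.

Lemma convop_sub_coef (G : groupType) (I J : finType) (iota : J -> I) lambda T
    (M : G -> J -> I -> C) v j x :
  uniq T -> 1%g \in T ->
  convop T (sub_coef iota lambda M) v j x = convop T M v j x - lambda * v (iota j) x.
Proof.
move=> UT T1; rewrite /convop /sub_coef.
under eq_bigr do under eq_bigr do rewrite mulrBl.
under eq_bigr do rewrite sumrB.
rewrite sumrB; congr (_ - _); rewrite (bigD1_seq 1%g) //= [X in _ + X]big1 => [|g /negPf g1].
  rewrite addr0 (bigD1 (iota j)) //= big1 => [|i /negPf ij].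
    by rewrite !eqxx /= mul1r addr0 invg1 mul1g.
  by rewrite [iota j == i]eq_sym ij andbF !mul0r.
by rewrite big1 // => i _; rewrite g1 !mul0r.
Qed.

(** For the transpose, only the rows in the range of [iota] see [lambda]. *)
Lemma convop_transp_sub_coef (G : groupType) (I J : finType) (iota : J -> I) lambda T
    (M : G -> J -> I -> C) w j x :
  uniq T -> 1%g \in T -> injective iota ->
  convop (inv_seq T) (transp (sub_coef iota lambda M)) w (iota j) x =
  convop (inv_seq T) (transp M) w (iota j) x - lambda * w j x.
Proof.
move=> UT T1 inj; rewrite !convop_tr /sub_coef.
under eq_bigr do under eq_bigr do rewrite mulrBl.
under eq_bigr do rewrite sumrB.
rewrite sumrB; congr (_ - _); rewrite (bigD1_seq 1%g) //= [X in _ + X]big1 => [|g /negPf g1].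
  rewrite addr0 (bigD1 j) //= big1 => [|i /negPf ij].
    by rewrite !eqxx /= mul1r addr0 mul1g.
  by rewrite (inj_eq inj) ij andbF !mul0r.
by rewrite big1 // => i _; rewrite g1 !mul0r.
Qed.

Section Compression.
Variables (N G Q : groupType).
Variables (incl : {multiplicative N -> G}) (p : {multiplicative G -> Q}).
Hypothesis incl_inj : injective incl.
Hypothesis exactness : forall g, p g = 1%g <-> exists n, incl n = g.
Variables (n d : nat) (t : 'I_n -> G).
Hypothesis t_inj : forall a b, p (t a) = p (t b) -> a = b.
Variables (T : seq G) (M : G -> 'I_d -> 'I_d -> C).
Hypothesis UT : uniq T.
Hypothesis M0 : forall g, g \notin T -> forall i j, M g i j = 0.

(** The indices [a] such that applying the inverse of an element of [T] to the
    coset of [t a] again gives one of the chosen cosets. *)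
Definition interior (a : 'I_n) : bool :=
  all (fun g => [exists b, p (t b) == (p g)^-1 * p (t a)]%g) T.

Let lift_ex a b g := exists m, (t a * incl m / t b = g)%g.

Definition lifts (g : G) (a b : 'I_n) : option N :=
  if pselect (lift_ex a b g) is left ex then Some (sval (cid ex)) else None.

(** The neutral element is included so that scalars can be subtracted. *)
Definition compress_supp : seq N :=
  undup (1%g :: pmap (fun x => lifts x.1 x.2.1 x.2.2)
     [seq (g, ab) | g <- T, ab <- enum {: 'I_n * 'I_n}]).

(** The elements of [G] from the coset of [t b] to the coset of [t a] are the
    [t a * m / t b] for [m] in [N]; a matrix over [G] thus becomes a matrix of
    [n] by [n] blocks over [N]. *)
Definition compress_coef (m : N) (ai bj : 'I_n * 'I_d) : C :=
  M (t ai.1 * incl m / t bj.1)%g ai.2 bj.2.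

Lemma coset_inj a b b' m m' :
  (t a * incl m / t b = t a * incl m' / t b')%g -> b = b' /\ m = m'.
Proof.
have p1 x : p (incl x) = 1%g by apply/exactness; exists x.
move=> E; have bb : b = b'.
  apply: t_inj; apply: invg_inj; apply: (mulgI (p (t a))).
  by have := congr1 p E; rewrite !gmulfM !p1 !mulg1 !morph_V.
by split=> //; apply: incl_inj; apply: (mulgI (t a)); apply: (mulIg (t b)^-1%g); rewrite E bb.
Qed.

Lemma mem_compress a b m : (t a * incl m / t b)%g \in T -> m \in compress_supp.
Proof.
move=> gT; rewrite mem_undup inE; apply/orP; right; rewrite mem_pmap; apply/mapP.
exists ((t a * incl m / t b)%g, (a, b)).
  by apply/allpairsP; exists ((t a * incl m / t b)%g, (a, b)); split; rewrite //= mem_enum.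
rewrite /lifts /=; case: pselect => [ex|[]]; last by exists m.
by have [_ ->] := coset_inj (svalP (cid ex)).
Qed.

(** On an interior coset nothing is lost: every element of the support of [M]
    leads to one of the chosen cosets, and to a single one. *)
Lemma compress_convop (v : 'I_d -> G -> C) a i x : interior a ->
  convop compress_supp compress_coef (fun bj y => v bj.2 (t bj.1 * incl y)%g) (a, i) x =
  convop T M v i (t a * incl x)%g.
Proof.
move=> /allP a_int; rewrite /convop.
pose phi (mb : N * 'I_n) := (t a * incl mb.1 / t mb.2)%g.
pose s := [seq phi mb | mb <- [seq (m, b) | m <- compress_supp, b <- enum 'I_n]].
have Us : uniq s.
  rewrite map_inj_uniq; last by move=> [m b] [m' b'] /coset_inj [/= -> ->].
  by apply: allpairs_uniq; [exact: undup_uniq | exact: enum_uniq | move=> [? ?] [? ?] _ _].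
rewrite -[RHS](@big_uniq_sub _ _ T s) //; first last.
- by move=> g gT; rewrite big1 // => j _; rewrite M0 ?mul0r.
- move=> g gT; have /existsP[b /eqP pb] := a_int g gT.
  have /exactness[m mE] : p ((t a)^-1 * g * t b)%g = 1%g.
    by rewrite !gmulfM morph_V pb !mulgA mulgK mulVg.
  have gE : g = phi (m, b) by rewrite /phi /= mE !mulgA mulgV mul1g mulgK.
  rewrite gE; apply: map_f; apply/allpairsP; exists (m, b); split=> //=.
    by apply: (@mem_compress a b); rewrite -/(phi (m, b)) -gE.
  by rewrite mem_enum.
rewrite big_map big_allpairs_dep /=; apply: eq_bigr => m _.
rewrite big_enum /= -(pair_bigA _ (fun b j => compress_coef m (a, i) (b, j) *
  v j (t b * incl (m^-1 * x))%g)) /=.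
apply: eq_bigr => b _; apply: eq_bigr => j _; congr (_ * v _ _).
by rewrite /phi /= gmulfM morph_V !invgM invgK !mulgA mulgVK.
Qed.

End Compression.
End FolnerExtension.

Section FolnerExtensionTheorem.
Variable R : realType.
Notation C := R[i].
Notation alg := (@is_algebraic R).
Notation AEP := (@algebraic_eigenvalue_property R).

Lemma l2_normalize (G : groupType) (I : finType) (v : I -> G -> C) :
  (forall i, l2 (v i)) -> (exists i x, v i x != 0) ->
  exists c : C, l2_le (realify (fun i x => c * v i x)) 1 /\
    exists ib x, realify (fun i x => c * v i x) ib x != 0.
Proof.
move=> vl2 [i0 [x0 v0]]; have [K vK] := l2_l2_le vl2.
have K0 := l2_le_ge0 vK; have K1 : 0 < K + 1 by rewrite ltr_wpDl.
pose a := (K + 1)^-1.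
have E : realify (fun i x => (Complex a 0) * v i x) = (fun ib x => a * realify v ib x).
  apply/funext => -[i b]; apply/funext => x; rewrite /realify /=.
  by case: (v i x) => y z /=; case: b; rewrite mul0r ?subr0 ?addr0.
exists (Complex a 0); rewrite E; split.
  move=> r Ur; apply: le_trans (l2_le_scale a vK Ur) _.
  by rewrite /a exprVn mulrC ler_pdivrMr ?exprn_gt0 // mul1r expr2; nra.
have a0 : a != 0 by rewrite invr_eq0 gt_eqF.
move: v0; case vE : (v i0 x0) => [y z]; rewrite eq_complex /= negb_and.
case/orP => h; [exists (i0, false)|exists (i0, true)]; exists x0; rewrite /realify /= vE mulf_neq0 //.
Qed.

Theorem aep_folner_extension (N G Q : groupType) :
  AEP N -> is_extension N G Q -> folner R Q -> AEP G.
Proof.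
move=> aepN [incl [p [incl_inj p_surj exactness]]] folQ d A Aalg lambda.
move=> [v0 [v0l2 v0n0 Av0]]; apply: contrapT => lam.
have [c [v1 [[i0 b0] [x0 theta0]]]] := l2_normalize v0l2 v0n0.
pose v i x := c * v0 i x; rewrite -/v in v1 theta0.
have [T [UT A0]] := group_ring_mx_supp A.
pose M g i j := A i j g.
have Mv i x : convop T M v i x = lambda * v i x.
  rewrite /v mulrCA -Av0 (mx_convolE _ UT A0) /convop mulr_sumr; apply: eq_bigr => g _.
  by rewrite mulr_sumr; apply: eq_bigr => j _; rewrite mulrCA.
set theta := realify v (i0, b0) x0 in theta0.
have th2 : 0 < theta ^+ 2 by rewrite exprn_even_gt0.
(* beats the factor [2 d], the number of real coordinates at a point of [G] *)
pose eps := theta ^+ 2 / (2 * d%:R + 1).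
have d1 : 0 < 2 * d%:R + 1 :> R by rewrite ltr_wpDl // mulr_ge0 ?ler0n.
have eps0 : 0 < eps by rewrite divr_gt0.
have [F [UF F0 Feps]] := folQ [seq (p g)^-1%g | g <- T] eps eps0.
pose n := size F.
pose q (a : 'I_n) := nth 1%g F a.
pose t (a : 'I_n) := sval (cid (p_surj (q a))).
have pt a : p (t a) = q a by exact: (svalP (cid (p_surj (q a)))).
have t_inj a b : p (t a) = p (t b) -> a = b.
  rewrite !pt => /eqP; rewrite /q nth_uniq // => /eqP ab; exact: val_inj.
have intE a : interior p t T a =
    all (fun e => (e * q a)%g \in F) [seq (p g)^-1%g | g <- T].
  rewrite /interior all_map; apply: eq_all => g /=; rewrite pt.
  apply/existsP/idP => [[b /eqP <-]|/(nthP 1%g)[k kn kE]].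
    by rewrite pt; exact: mem_nth.
  by exists (Ordinal kn); rewrite pt /q /= kE.
pose I := {a : 'I_n | interior p t T a}.
pose IJ : finType := (I * 'I_d)%type; pose J : finType := ('I_n * 'I_d)%type.
pose iota (ai : IJ) : J := (val ai.1, ai.2).
have iota_inj : injective iota.
  by move=> [a i] [b j] [ab ->]; congr (_, _); exact: val_inj.
pose S := compress_supp incl t T.
have US : uniq S by exact: undup_uniq.
have S1 : 1%g \in S by rewrite mem_undup mem_head.
pose L0 : N -> IJ -> J -> C := fun m ai bj => compress_coef incl t M m (iota ai) bj.
(* the rows of [A - lambda] above the interior of [F], as a matrix over [N] *)
pose L := sub_coef iota lambda L0.
(* the transpose of [L] is injective, since [lambda] is no eigenvalue of an algebraic matrix over [N] *)
have B_inj (u : vec R N (IJ * bool)%type) K : l2_le u K ->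
    convop (inv_seq S) (transp (real_coef L)) u = (fun _ _ => 0) -> u = (fun _ _ => 0).
  move=> uK Bu; apply: contrapT => u0; apply: lam.
  pose y ai x := conjc (complexify u ai x).
  have yK : l2_le (realify y) K.
    move=> r Ur; apply: le_trans (uK r Ur); apply: ler_sum => -[ai b] _.
    apply: ler_sum => x _; rewrite /realify /y /complexify /=.
    by case: b; rewrite /= ?sqrrN.
  have By : convop (inv_seq S) (transp L) y = (fun _ _ => 0).
    have : realify (convop (inv_seq S) (conj_coef (transp L)) (complexify u)) = realify (fun _ _ => 0).
      by rewrite -convop_realify complexifyK -transp_real_coef Bu realify0.
    have -> : complexify u = (fun i x => conjc (y i x)).
      by apply/funext => i; apply/funext => x; rewrite /y conjcK.
    move=> /(can_inj (@realifyK _ _ _)); rewrite convop_conj => By.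
    apply/funext => i; apply/funext => x.
    have := congr1 (fun f => conjc (f i x)) By; by rewrite conjcK rmorph0.
  apply: (aep_convop aepN (T := inv_seq S)
     (M := fun m ai bj => compress_coef incl t M m^-1%g (iota bj) (iota ai)) (v := y)).
  - by rewrite map_inj_uniq //; exact: invg_inj.
  - by move=> m ai bj; exact: Aalg.
  - exact: l2_le_l2 yK.
  - apply: contrapT => y0; apply: u0; rewrite -[u]complexifyK -[RHS]realify0; congr realify.
    apply/funext => i; apply/funext => x; apply: contrapT => /eqP ux.
    apply: y0; exists i, x; rewrite /y; apply: contra ux => /eqP yx.
    by rewrite -[complexify u i x]conjcK yx rmorph0.
  - move=> ai x; have := congr1 (fun f => f (iota ai) x) By.
    rewrite convop_transp_sub_coef // => /eqP; rewrite subr_eq0 => /eqP <-.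
    by [].
(* translates of the eigenvector whose coordinate at [jb] is its value at [x0] *)
pose f (jb : J * bool) : vec R N (J * bool)%type :=
  fun kb m => realify v (kb.1.2, kb.2) (t kb.1.1 * incl m * ((t jb.1.1)^-1 * x0))%g.
have f1 jb : l2_le (f jb) 1.
  apply: (l2_le_inj (p := fun kb m => ((kb.1.2, kb.2),
    (t kb.1.1 * incl m * ((t jb.1.1)^-1 * x0))%g)) _ v1).
  move=> [[a i] b] [[a' i'] b'] m m' /= [-> -> /mulIg E].
  have p1 y : p (incl y) = 1%g by apply/exactness; exists y.
  have aa : a = a' by apply: t_inj; have := congr1 p E; rewrite !gmulfM !p1 !mulg1.
  by move: E; rewrite aa => /mulgI /incl_inj ->.
have f0 jb : convop S (real_coef L) (f jb) = (fun _ _ => 0).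
  pose w (kj : J) m := v kj.2 (t kj.1 * incl m * ((t jb.1.1)^-1 * x0))%g.
  have -> : f jb = realify w by apply/funext => -[[a i] b].
  rewrite convop_realify -[RHS]realify0; congr realify; apply/funext => ai; apply/funext => m.
  rewrite convop_sub_coef //; apply/eqP; rewrite subr_eq0; apply/eqP.
  have := compress_convop incl_inj exactness t_inj UT A0
    (fun i x => v i (x * ((t jb.1.1)^-1 * x0))%g) ai.2 m (valP ai.1).
  by rewrite convop_rtrans Mv.
have := @rank_convop N R (IJ * bool)%type (J * bool)%type (inv_seq S) (transp (real_coef L)) f B_inj f1.
rewrite inv_seqK transpK => /(_ f0).
(* only the coordinates [(a, i0, b0)] are kept; each contributes [theta^2] *)
have lower : n%:R * theta ^+ 2 <= \sum_jb f jb jb 1%g ^+ 2.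
  rewrite -(pair_bigA _ (fun aj b => f (aj, b) (aj, b) 1%g ^+ 2)) /=.
  rewrite -(pair_bigA _ (fun a j => \sum_b f ((a, j), b) ((a, j), b) 1%g ^+ 2)) /=.
  rewrite mulr_natl -[n in leLHS](card_ord n) -sumr_const; apply: ler_sum => a _.
  rewrite (bigD1 i0) //= (bigD1 b0) //= /f /= morph_1 mulg1 mulVKg -/theta -addrA lerDl.
  apply: addr_ge0; apply: sumr_ge0 => ? _; first exact: sqr_ge0.
  by apply: sumr_ge0 => ? _; exact: sqr_ge0.
have cardI : (#|{: I}| + count (fun q => ~~ all (fun e => (e * q)%g \in F)
    [seq (p g)^-1%g | g <- T]) F = n)%N.
  rewrite -[RHS](count_predC (fun q => all (fun e => (e * q)%g \in F)
    [seq (p g)^-1%g | g <- T])); congr (_ + _)%N.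
  rewrite card_sig -sum1_count (big_nth 1%g) big_mkord -sum1_card.
  by apply: eq_bigl => a; rewrite unfold_in /= intE.
have n0 : 0 < n%:R :> R by rewrite ltr0n.
move: Feps; rewrite -/n => Feps upper; move: (le_trans lower upper).
rewrite !card_prod card_bool !card_ord !natrM.
have En : n%:R = #|{: I}|%:R + (count (fun q => ~~ all (fun e => (e * q)%g \in F)
    [seq (p g)^-1%g | g <- T]) F)%:R :> R by rewrite -natrD cardI.
move: Feps En; set k := (count _ _)%:R => Feps En.
have -> : n%:R * d%:R * 2%:R - #|{: I}|%:R * d%:R * 2%:R = 2 * d%:R * k :> R.
  by rewrite En; ring.
move=> h; have h2 : n%:R * theta ^+ 2 <= 2 * d%:R * (eps * n%:R).
  by apply: le_trans h _; rewrite ler_wpM2l // mulr_ge0 ?ler0n.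
have : n%:R * theta ^+ 2 * (2 * d%:R + 1) <= 2 * d%:R * theta ^+ 2 * n%:R.
  have -> : 2 * d%:R * theta ^+ 2 * n%:R = 2 * d%:R * (eps * n%:R) * (2 * d%:R + 1).
    by rewrite /eps; field; rewrite gt_eqF.
  by rewrite ler_wpM2r // ltW.
have : 0 < n%:R * theta ^+ 2 by exact: mulr_gt0.
by lra.
Qed.

End FolnerExtensionTheorem.

(** * Extensions with elementary amenable quotient *)

Section Pullback.
Variables (G Q H : groupType).
Variables (p : {multiplicative G -> Q}) (i : {multiplicative H -> Q}).

Definition pullback_pred : pred G := fun g => `[< exists h, i h = p g >].

Record pullback := Pullback { pullback_val : G; _ : pullback_pred pullback_val }.

HB.instance Definition _ := [isSub for pullback_val].
HB.instance Definition _ := [Choice of pullback by <:].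

Fact pullback_closed : group_closed pullback_pred.
Proof.
split; first by apply/asboolP; exists 1%g; rewrite !morph_1.
move=> x y /asboolP[h hx] /asboolP[k ky]; apply/asboolP; exists (h / k)%g.
by rewrite !gmulfM !morph_V hx ky.
Qed.

HB.instance Definition _ := SubChoice_isSubGroup.Build G pullback_pred pullback pullback_closed.

Lemma pullbackP (x : pullback) : exists h, i h = p (val x).
Proof. by case: x => g /= /asboolP. Qed.

Definition pullback_proj (x : pullback) : H := sval (cid (pullbackP x)).

Lemma pullback_projE x : i (pullback_proj x) = p (val x).
Proof. exact: (svalP (cid (pullbackP x))). Qed.

End Pullback.

Definition mkmorph (G H : groupType) (f : G -> H) (fM : {morph f : x y / (x * y)%g}) :
  {multiplicative G -> H} := HB.pack f (isMultiplicative.Build G H f fM).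

Section ElementaryAmenable.
Variable R : realType.
Notation AEP := (@algebraic_eigenvalue_property R).

Lemma pullback_extension (N G Q H : groupType) (incl : {multiplicative N -> G})
    (p : {multiplicative G -> Q}) (i : {multiplicative H -> Q}) :
  injective incl -> (forall q, exists g, p g = q) ->
  (forall g, p g = 1%g <-> exists n, incl n = g) -> injective i ->
  is_extension N (pullback p i) H.
Proof.
move=> incl_inj p_surj exactness i_inj.
have p1 n : p (incl n) = 1%g by apply/exactness; exists n.
have Pincl n : pullback_pred p i (incl n).
  by apply/asboolP; exists 1%g; rewrite morph_1 p1.
pose f n := Pullback (Pincl n).
have fM : {morph f : x y / (x * y)%g}.
  by move=> x y; apply: val_inj; rewrite valM /= gmulfM.
have pM : {morph @pullback_proj _ _ _ p i : x y / (x * y)%g}.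
  by move=> x y; apply: i_inj; rewrite gmulfM !pullback_projE valM gmulfM.
exists (mkmorph fM), (mkmorph pM); split=> /=.
- by move=> x y /(congr1 val) /= /incl_inj.
- move=> h; have [g gh] := p_surj (i h).
  have Pg : pullback_pred p i g by apply/asboolP; exists h.
  by exists (Pullback Pg); apply: i_inj; rewrite pullback_projE.
- move=> x; split=> [x1|[n <-]]; last by apply: i_inj; rewrite pullback_projE /= p1 morph_1.
  have /exactness[n nx] : p (val x) = 1%g by rewrite -pullback_projE x1 morph_1.
  by exists n; apply: val_inj.
Qed.

Lemma valM_pullback (G Q H : groupType) (p : {multiplicative G -> Q})
  (i : {multiplicative H -> Q}) : {morph (val : pullback p i -> G) : x y / (x * y)%g}.
Proof. by move=> x y; rewrite valM. Qed.

Lemma count_le_in (T : eqType) (a b : pred T) (s : seq T) :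
  {in s, forall x, a x -> b x} -> (count a s <= count b s)%N.
Proof.
elim: s => //= x s IH ab; apply: leq_add; last first.
  by apply: IH => y ys; apply: ab; rewrite inE ys orbT.
by have := ab x (mem_head _ _); case: (a x) => // ->.
Qed.

Lemma folner_finite (Q : groupType) : is_finite_group Q -> folner R Q.
Proof.
move=> finQ E eps eps0; exists (fset_set [set: Q]).
have all_in q : q \in fset_set [set: Q] by rewrite in_fset_set // in_setT.
split; first exact: fset_uniq.
  by have := all_in 1%g; rewrite -index_mem; exact: leq_ltn_trans.
rewrite (@eq_in_count _ _ pred0) ?count_pred0.
  by rewrite mulr_ge0 ?ler0n // ltW.
by move=> q _ /=; apply/negbTE; rewrite negbK; apply/allP => e _; exact: all_in.
Qed.

(** Long intervals of powers of a generator are almost invariant. *)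
Lemma folner_cyclic (Q : groupType) : is_cyclic Q -> folner R Q.
Proof.
move=> [g gQ].
have [finQ|infQ] := pselect (is_finite_group Q); first exact: folner_finite.
have g_inj : injective (fun n => g ^+ n)%g.
  suff lt_neq a b : (a < b)%N -> (g ^+ a <> g ^+ b)%g.
    by move=> a b /= ab; case: (ltngtP a b) => // /lt_neq; [move=> /(_ ab) | move=> /(_ (esym ab))].
  move=> ab Eab; apply: infQ.
  pose k := (b - a)%N; have k0 : (0 < k)%N by rewrite subn_gt0.
  have gk : (g ^+ k)%g = 1%g.
    by rewrite expgnFr ?(ltnW ab) // Eab mulgV.
  have gmod n : (g ^+ n)%g = (g ^+ (n %% k))%g.
    by rewrite {1}(divn_eq n k) expgnDr mulnC expgnA gk expg1n mul1g.
  apply: (@sub_finite_set _ _ ((fun n => (g ^+ n)%g) @` `I_k.+1)).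
    move=> x _; have [n [->|->]] := gQ x.
      by exists (n %% k)%N; rewrite -?gmod //= ltnS ltnW // ltn_pmod.
    exists (k - n %% k)%N; first by rewrite /= ltnS leq_subr.
    rewrite (gmod n) expgnFr ?gk ?mul1g //; exact/ltnW/ltn_pmod.
  exact/finite_image/finite_II.
move=> E eps eps0.
have [m mE] : exists m, forall e, e \in E -> exists2 n, (n <= m)%N &
    (e = g ^+ n \/ e = g ^- n)%g.
  elim: E => [|e E [m mE]]; first by exists 0%N.
  have [n ne] := gQ e; exists (maxn m n) => e'; rewrite inE => /predU1P[->|/mE[n' nm en']].
    by exists n; rewrite ?leq_maxr.
  by exists n'; rewrite ?leq_max ?nm.
(* an interval of length [L] loses at most [2 m] points *)
pose L := (Num.bound ((2 * m)%:R / eps)).+1.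
pose F := [seq (g ^+ k)%g | k <- iota 0 L].
have UF : uniq F by rewrite map_inj_uniq ?iota_uniq.
exists F; split=> //.
have memF k : (k < L)%N -> (g ^+ k)%g \in F by move=> kL; apply: map_f; rewrite mem_iota.
rewrite size_map size_iota count_map.
have le_count : (count (fun k => ~~ all (fun e => (e * g ^+ k)%g \in F) E) (iota 0 L) <=
    count (predU (fun k => k < m)%N (fun k => L - m <= k)%N) (iota 0 L))%N.
  apply: count_le_in => k; rewrite mem_iota add0n => /= kL.
  apply: contraNT; rewrite negb_or -leqNgt -ltnNge => /andP[mk kLm].
  apply/allP => e /mE[n nm [->|->]].
    rewrite -expgnDr; apply: memF.
    by apply: (@leq_ltn_trans (m + k)); rewrite ?leq_add2r // -ltn_subRL.
  have -> : (g ^- n * g ^+ k)%g = (g ^+ (k - n))%g.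
    by rewrite -{1}(subnKC (leq_trans nm mk)) expgnDr mulKg.
  by apply: memF; apply: leq_ltn_trans kL; exact: leq_subr.
have le2m : (count (predU (fun k => k < m)%N (fun k => L - m <= k)%N) (iota 0 L) <= m + m)%N.
  apply: (@leq_trans (count (fun k => k < m)%N (iota 0 L) + count (fun k => L - m <= k)%N (iota 0 L))).
    by rewrite -count_predUI leq_addr.
  apply: leq_add; rewrite -size_filter.
    rewrite -[leqRHS](size_iota 0); apply: uniq_leq_size; first by rewrite filter_uniq ?iota_uniq.
    by move=> k; rewrite mem_filter !mem_iota => /andP[].
  rewrite -[leqRHS](size_iota (L - m)); apply: uniq_leq_size; first by rewrite filter_uniq ?iota_uniq.
  move=> k; rewrite mem_filter !mem_iota add0n => /andP[-> /= kL].
  by rewrite (leq_trans kL) // addnC -maxnE leq_maxr.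
apply: (@le_trans _ _ (2 * m)%:R).
  by rewrite ler_nat mul2n -addnn (leq_trans le_count).
have := archi_boundP (_ : 0 <= (2 * m)%:R / eps).
rewrite divr_ge0 ?ler0n ?(ltW eps0) // => /(_ isT) lt.
rewrite mulrC -ler_pdivrMr //; apply: le_trans (ltW lt) _.
by rewrite ler_nat.
Qed.

(** The closure property that elementary amenable groups inherit along
    extensions and directed unions. *)
Definition good_quotient (Q : groupType) : Prop :=
  forall N G : groupType, AEP N -> is_extension N G Q -> AEP G.

(** If [Q] is an extension of [Q'] by [N'], the preimage of [N'] in [G] is an
    extension of [N'] by [N], and [G] is an extension of [Q'] by that preimage.
    If [Q] is a directed union, so is [G], of the preimages. *)
Lemma good_elementary_amenable (Q : groupType) : elementary_amenable Q -> good_quotient Q.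
Proof.
elim=> {Q} [Q cQ N G aN ext|Q fQ N G aN ext|N' Q Q' _ IHN _ IHQ [i' [p' [i'_inj p'_surj ex']]] N G aN ext|Q I H _ IH [f [finj fdir fcov]] N G aN ext].
- exact: aep_folner_extension aN ext (folner_cyclic cQ).
- exact: aep_folner_extension aN ext (folner_finite fQ).
- case: ext => incl [p [incl_inj p_surj exactness]].
  have aP : AEP (pullback p i').
    exact: IHN aN (pullback_extension incl_inj p_surj exactness i'_inj).
  apply: IHQ aP _.
  have compM : {morph (fun g => p' (p g)) : x y / (x * y)%g} by move=> x y; rewrite !gmulfM.
  exists (mkmorph (@valM_pullback _ _ _ p i')), (mkmorph compM); split=> /=.
  + exact: val_inj.
  + by move=> q; have [y <-] := p'_surj q; have [g <-] := p_surj y; exists g.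
  + move=> g; split=> [/ex' ex|[x <-]]; last by apply/ex'; exact: pullbackP.
    have Pg : pullback_pred p i' g by apply/asboolP.
    by exists (Pullback Pg).
- case: ext => incl [p [incl_inj p_surj exactness]].
  apply: (@aep_directed_union _ _ I (fun k => pullback p (f k))) => [k|].
    exact: IH aN (pullback_extension incl_inj p_surj exactness (finj k)).
  exists (fun k => mkmorph (@valM_pullback _ _ _ p (f k))); split=> /= [k|k l|].
  + exact: val_inj.
  + have [m [km lm]] := fdir k l; exists m; split=> _ [x _ <-].
      have [h hx] := pullbackP x; have [h' _ h'x] := km _ (imageT (f k) h).
      have Px : pullback_pred p (f m) (val x) by apply/asboolP; exists h'; rewrite h'x.
      by exists (Pullback Px).
    have [h hx] := pullbackP x; have [h' _ h'x] := lm _ (imageT (f l) h).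
    have Px : pullback_pred p (f m) (val x) by apply/asboolP; exists h'; rewrite h'x.
    by exists (Pullback Px).
  + rewrite -subTset => g _; have : (\bigcup_i range (f i)) (p g) by rewrite fcov.
    move=> [k _ [h _ hg]]; exists k => //.
    have Pg : pullback_pred p (f k) g by apply/asboolP; exists h.
    by exists (Pullback Pg).
Qed.

End ElementaryAmenable.

(** * Linear functionals below a sublinear one *)

Section DominatedFunctional.
Variables (R : realType) (G : groupType) (I : finType).
Notation vec := (vec R G I).
Notation vec0 := ((fun _ _ => 0) : vec).
Implicit Types (p q : vec -> R) (u v : vec).

Definition sublin p : Prop := p vec0 <= 0 /\
  forall a u v, 0 <= a -> finite_vec u -> finite_vec v -> p (lincomb a u v) <= a * p u + p v.

Lemma finite_vec0 : finite_vec vec0.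
Proof. by move=> i; exact: fin_supp0. Qed.

Lemma lincomb0 u : lincomb 0 u vec0 = vec0.
Proof. by apply/funext => i; apply/funext => x; rewrite /lincomb mul0r addr0. Qed.

Lemma lincomb0l u v : lincomb 0 u v = v.
Proof. by apply/funext => i; apply/funext => x; rewrite /lincomb mul0r add0r. Qed.

Lemma lincomb1N u : lincomb 1 u (lincomb (-1) u vec0) = vec0.
Proof. by apply/funext => i; apply/funext => x; rewrite /lincomb; ring. Qed.

Lemma sublin_zero p : sublin p -> p vec0 = 0.
Proof.
move=> [p0 psub]; apply/eqP; rewrite eq_le p0 /=.
have := psub 1 vec0 vec0 ler01 finite_vec0 finite_vec0.
have -> : lincomb 1 vec0 vec0 = vec0.
  by apply/funext => i; apply/funext => x; rewrite /lincomb mulr0 addr0.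
by rewrite mul1r lerDl.
Qed.

Lemma sublin_opp p u : sublin p -> finite_vec u -> - p (lincomb (-1) u vec0) <= p u.
Proof.
move=> ps fu; have := ps.2 1 u (lincomb (-1) u vec0) ler01 fu (finite_vec_lincomb _ fu finite_vec0).
rewrite lincomb1N (sublin_zero ps); lra.
Qed.

(** The common step of three constructions below: an infimum of a family of
    functionals is sublinear once any two members can be combined into a
    third. *)
Lemma sublin_inf (S : Type) (A : set S) (Phi : S -> vec -> R) :
  (exists2 s, A s & Phi s vec0 <= 0) ->
  (forall u, finite_vec u -> exists b, forall s, A s -> b <= Phi s u) ->
  (forall a u v s t, 0 < a -> finite_vec u -> finite_vec v -> A s -> A t ->
     exists2 w, A w & Phi w (lincomb a u v) <= a * Phi s u + Phi t v) ->
  let P u := inf [set Phi s u | s in A] in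
  sublin P /\ forall u s, finite_vec u -> A s -> P u <= Phi s u.
Proof.
move=> [s0 As0 Phi0] bnd sub P.
have Ple u s : finite_vec u -> A s -> P u <= Phi s u.
  move=> fu As; apply: ge_inf; last by exists s.
  by have [b bP] := bnd u fu; exists b => _ [t At <-]; exact: bP.
split=> //; split=> [|a u v]; first exact: le_trans (Ple _ _ finite_vec0 As0) Phi0.
rewrite le_eqVlt => /predU1P[<-|a0] fu fv; first by rewrite lincomb0l mul0r add0r.
have step s t : A s -> A t -> P (lincomb a u v) <= a * Phi s u + Phi t v.
  move=> As At; have [w Aw] := sub a u v s t a0 fu fv As At.
  by apply: le_trans; apply: Ple => //; exact: finite_vec_lincomb.
rewrite -lerBlDr -ler_pdivrMl //; apply: lb_le_inf; first by exists (Phi s0 u), s0.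
move=> _ [s As <-]; rewrite ler_pdivrMl // lerBlDr -lerBlDl.
apply: lb_le_inf; first by exists (Phi s0 v), s0.
by move=> _ [t At <-]; rewrite lerBlDl; exact: step.
Qed.

(** Zorn's lemma: the infimum of a chain is again sublinear, and bounded below
    by [u |-> - q (- u)]. *)
Lemma minimal_sublin q : sublin q -> exists p, [/\ sublin p,
  forall u, finite_vec u -> p u <= q u &
  forall p', sublin p' -> (forall u, finite_vec u -> p' u <= p u) -> forall u, finite_vec u -> p u <= p' u].
Proof.
move=> qs.
pose S := {p | sublin p /\ forall u, finite_vec u -> p u <= q u}.
pose mk p (h : sublin p /\ forall u, finite_vec u -> p u <= q u) : S := exist _ p h.
pose s0 := mk q (conj qs (fun u _ => lexx _)).
pose rel (s t : S) := `[< forall u, finite_vec u -> sval t u <= sval s u >].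
have [//| | |s smin] := @ZL_preorder S s0 rel.
- by move=> s; apply/asboolP.
- move=> s r t /asboolP sr /asboolP rt; apply/asboolP => u fu.
  exact: le_trans (rt u fu) (sr u fu).
- move=> A Atot; have [[s1 As1]|A0] := pselect (exists s, A s); last first.
    by exists s0 => s As; case: A0; exists s.
  have [|||Ps Ple] := @sublin_inf S A (fun s => sval s).
  + by exists s1 => //; have [[]] := svalP s1.
  + move=> u fu; exists (- q (lincomb (-1) u vec0)) => s As; have [ss sq] := svalP s.
    apply: le_trans (sublin_opp ss fu); rewrite lerN2; apply: sq.
    exact: finite_vec_lincomb fu finite_vec0.
  + move=> a u v s t a0 fu fv As At.
    have [/asboolP st|/asboolP ts] := Atot s t As At.
    * exists t => //; have [ts _] := svalP t.
      apply: le_trans (ts.2 a u v (ltW a0) fu fv) _; rewrite lerD2r ler_pM2l //.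
      exact: st.
    * exists s => //; have [ss _] := svalP s.
      apply: le_trans (ss.2 a u v (ltW a0) fu fv) _; rewrite lerD2l; exact: ts.
  have Pq u : finite_vec u -> inf [set sval s u | s in A] <= q u.
    by move=> fu; apply: le_trans (Ple u s1 fu As1) _; have [_] := svalP s1; apply.
  exists (mk _ (conj Ps Pq)) => s As; apply/asboolP => u fu; exact: Ple.
have [ss sq] := svalP s; exists (sval s); split=> // p' p's p'le u fu.
have p'q v : finite_vec v -> p' v <= q v by move=> fv; apply: le_trans (p'le v fv) (sq v fv).
pose t := mk p' (conj p's p'q).
have /asboolP : rel t s; last by apply.
by apply: smin; apply/asboolP.
Qed.

(** The Hahn-Banach theorem for finitely supported vectors.  A minimal
    sublinear [p] is additive: for fixed [x] the infimum over [t >= 0] of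
    [p (y + t x) - t p x] is a sublinear function of [y] below [p], hence equal
    to [p], and the choice [t = 1] gives [p y + p x <= p (y + x)]. *)
Theorem dominated_functional q : sublin q ->
  exists phi : vec, forall u, finite_vec u -> dotp u phi <= q u.
Proof.
move=> /minimal_sublin[p [ps pq pmin]].
have pD x y : finite_vec x -> finite_vec y -> p y + p x <= p (lincomb 1 x y).
  move=> fx fy.
  have homt t : 0 <= t -> p (lincomb t x vec0) = t * p x.
    rewrite le_eqVlt => /predU1P[<-|t0]; first by rewrite lincomb0 sublin_zero ?mul0r.
    apply/eqP; rewrite eq_le; apply/andP; split.
      by have := ps.2 t x vec0 (ltW t0) fx finite_vec0; rewrite (sublin_zero ps) addr0.
    have := ps.2 t^-1 (lincomb t x vec0) vec0 (ltW _) (finite_vec_lincomb _ fx finite_vec0) finite_vec0.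
    rewrite invr_gt0 (sublin_zero ps) addr0 => /(_ t0).
    rewrite (_ : lincomb t^-1 _ _ = x) => [|]; last first.
      by apply/funext => i; apply/funext => z; rewrite /lincomb !addr0 mulKf // gt_eqF.
    by rewrite ler_pdivlMl.
  pose Phi (t : R) z := p (lincomb t x z) - t * p x.
  have [|||Ps Ple] := @sublin_inf R [set t | 0 <= t] Phi.
  - by exists 0 => //=; rewrite /Phi lincomb0l mul0r subr0; exact: ps.1.
  - move=> z fz; exists (- p (lincomb (-1) z vec0)) => t /= t0.
    rewrite /Phi lerBrDr addrC lerBlDr -homt //.
    have := ps.2 1 (lincomb t x z) (lincomb (-1) z vec0) ler01 (finite_vec_lincomb _ fx fz) (finite_vec_lincomb _ fz finite_vec0).
    rewrite mul1r (_ : lincomb 1 _ _ = lincomb t x vec0) //.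
    by apply/funext => i; apply/funext => k; rewrite /lincomb; ring.
  - move=> a u v s t a0 fu fv /= s0 t0; exists (a * s + t).
      by rewrite /= addr_ge0 // mulr_ge0 // ltW.
    rewrite /Phi.
    have := ps.2 a (lincomb s x u) (lincomb t x v) (ltW a0) (finite_vec_lincomb _ fx fu) (finite_vec_lincomb _ fx fv).
    rewrite (_ : lincomb a _ _ = lincomb (a * s + t) x (lincomb a u v)); last first.
      by apply/funext => i; apply/funext => k; rewrite /lincomb; ring.
    by move=> h; nra.
  have := pmin _ Ps; move=> /(_ _ y fy) h.
  have {}h := le_trans (h _) (Ple y 1 fy ler01); rewrite /Phi mul1r in h.
  rewrite -lerBrDr; apply: h => u fu.
  by apply: le_trans (Ple u 0 fu (lexx _)) _; rewrite /Phi lincomb0l mul0r subr0.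
have padd x y : finite_vec x -> finite_vec y -> p (lincomb 1 x y) = p x + p y.
  move=> fx fy; apply/eqP; rewrite eq_le addrC pD // andbT addrC.
  by have := ps.2 1 x y ler01 fx fy; rewrite mul1r.
have pZ a x : finite_vec x -> p (lincomb a x vec0) = a * p x.
  move=> fx.
  have pos b : 0 <= b -> p (lincomb b x vec0) <= b * p x.
    by move=> b0; have := ps.2 b x vec0 b0 fx finite_vec0; rewrite (sublin_zero ps) addr0.
  have fN : finite_vec (lincomb (-1) x vec0) := finite_vec_lincomb _ fx finite_vec0.
  have pN y : finite_vec y -> p (lincomb (-1) y vec0) = - p y.
    move=> fy; apply/eqP; rewrite -addr_eq0 addrC -padd ?lincomb1N ?sublin_zero //.
    exact: finite_vec_lincomb fy finite_vec0.
  have posE b : 0 <= b -> p (lincomb b x vec0) = b * p x.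
    move=> b0; apply/eqP; rewrite eq_le pos //=.
    have := ps.2 b _ vec0 b0 fN finite_vec0; rewrite (sublin_zero ps) addr0 pN //.
    rewrite (_ : lincomb b _ _ = lincomb (-1) (lincomb b x vec0) vec0) ?pN ?mulrN ?lerN2 //.
      exact: finite_vec_lincomb fx finite_vec0.
    by apply/funext => i; apply/funext => k; rewrite /lincomb; ring.
  have [a0|a0] := leP 0 a; first exact: posE.
  have -> : lincomb a x vec0 = lincomb (-1) (lincomb (- a) x vec0) vec0.
    by apply/funext => i; apply/funext => k; rewrite /lincomb; ring.
  rewrite pN ?posE ?oppr_ge0 ?(ltW a0) ?mulNr ?opprK //.
  exact: finite_vec_lincomb fx finite_vec0.
exists (fun i x => p (delta i x)) => u fu; apply: le_trans (pq u fu).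
have [r Ur ur] := finite_vec_uniq fu.
have pL a x y : finite_vec x -> finite_vec y -> p (lincomb a x y) = a * p x + p y.
  move=> fx fy; rewrite -pZ // -padd //; last exact: finite_vec_lincomb fx finite_vec0.
  by congr p; apply/funext => i; apply/funext => k; rewrite /lincomb; ring.
pose comb (s : seq (I * G)) : vec := fun j y => \sum_(z <- s) u z.1 z.2 * delta z.1 z.2 j y.
have pcomb s : finite_vec (comb s) /\ p (comb s) = \sum_(z <- s) u z.1 z.2 * p (delta z.1 z.2).
  elim: s => [|z s [fc pc]].
    rewrite big_nil (_ : comb [::] = vec0) ?sublin_zero; first by split=> //; exact: finite_vec0.
      by [].
    by apply/funext => j; apply/funext => y; rewrite /comb big_nil.
  have E : comb (z :: s) = lincomb (u z.1 z.2) (delta z.1 z.2) (comb s).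
    by apply/funext => j; apply/funext => y; rewrite /comb big_cons.
  rewrite E big_cons pL ?pc //; last exact: finite_vec_delta.
  by split=> //; apply: finite_vec_lincomb => //; exact: finite_vec_delta.
have [_ pc] := pcomb [seq (i, x) | i <- enum I, x <- r].
rewrite big_allpairs_dep big_enum /= in pc.
rewrite (dotpE _ Ur ur) -pc le_eqVlt; apply/orP; left; apply/eqP; congr p.
apply/funext => j; apply/funext => y.
rewrite /comb big_allpairs_dep big_enum /= (bigD1 j) //= [X in _ + X]big1 => [|i /negPf ij].
  rewrite addr0; have [yr|yr] := boolP (y \in r).
    rewrite (bigD1_seq y) //= [X in _ + X]big1 => [|z /negPf zy]; first by rewrite /delta !eqxx mulr1 addr0.
    by rewrite /delta eqxx [y == z]eq_sym zy mulr0.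
  rewrite ur // big_seq big1 // => z zr.
  by rewrite /delta eqxx; case: eqP => [yz|]; rewrite ?mulr0 // -yz ur ?mul0r.
by rewrite big1 // => z _; rewrite /delta [j == i]eq_sym ij mulr0.
Qed.

End DominatedFunctional.

(** * From invariant means to Folner sets *)

Section AmenableFolner.
Variables (R : realType) (Q : groupType).
Variables (k : nat) (e : 'I_k -> Q).
Notation vec := (vec R Q 'I_k).
Implicit Types (h : Q -> R).

Definition sum_pos_part (u : vec) : R := \sum_i fsum (fun x => Num.max (u i x) 0).

Definition edge_diff h : vec := fun i x => h x - h (e i * x)%g.

Lemma finite_vec_max (u : vec) i : finite_vec u -> fin_supp (fun x => Num.max (u i x) 0).
Proof. by move=> /(_ i)[r ur]; exists r => x /ur ->; rewrite maxxx. Qed.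

Lemma finite_vec_edge_diff h : fin_supp h -> finite_vec (edge_diff h).
Proof.
move=> fh i; have := fin_supp_trans (e i)^-1%g fh; rewrite invgK => fh'.
have := fin_suppD fh (fin_suppMl (fun=> -1) fh').
by congr fin_supp; apply/funext => x; rewrite /edge_diff mulN1r.
Qed.

Lemma sublin_sum_pos_part : sublin sum_pos_part.
Proof.
split=> [|a u v a0 fu fv].
  by rewrite /sum_pos_part big1 // => i _; rewrite -[RHS](@fsum0 R Q); apply: eq_fsum => x; rewrite maxxx.
rewrite /sum_pos_part mulr_sumr -big_split; apply: ler_sum => i _ /=.
rewrite -fsumZ -fsumD; [|exact/fin_suppMl/finite_vec_max|exact: finite_vec_max].
apply: le_fsum; first exact/finite_vec_max/finite_vec_lincomb.
  by apply: fin_suppD; [exact/fin_suppMl/finite_vec_max|exact: finite_vec_max].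
move=> x; rewrite /lincomb ge_max; apply/andP; split.
  apply: lerD; last by rewrite le_max lexx.
  by rewrite ler_wpM2l // le_max lexx.
by rewrite addr_ge0 ?mulr_ge0 // le_max lexx orbT.
Qed.

Definition indicator (F : seq Q) : Q -> R := fun x => (x \in F)%:R.

Lemma fin_supp_indicator F : fin_supp (indicator F).
Proof. by exists F => x /negPf xF; rewrite /indicator xF. Qed.

Lemma fsum_indicator F : uniq F -> fsum (indicator F) = (size F)%:R.
Proof.
move=> UF; rewrite (fsumE UF) => [|x /negPf xF]; last by rewrite /indicator xF.
rewrite big_seq (eq_bigr (fun=> 1)) => [|x xF]; last by rewrite /indicator xF.
by rewrite -big_seq big_const_seq count_predT iter_addr_0.
Qed.

(** Layer cake: the isoperimetric inequality for finite sets extends to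
    nonnegative functions, by subtracting the indicator of the support times
    the least nonzero value. *)
Lemma coarea (eps : R) :
  (forall F : seq Q, uniq F -> eps * (size F)%:R <= sum_pos_part (edge_diff (indicator F))) ->
  forall h, (forall x, 0 <= h x) -> fin_supp h -> eps * fsum h <= sum_pos_part (edge_diff h).
Proof.
move=> isop h h0 fh.
have [r Ur [rpos rout]] : exists2 r, uniq r &
    (forall x, x \in r -> 0 < h x) /\ (forall x, x \notin r -> h x = 0).
  have [r Ur rP] := fin_supp_uniq fh; exists [seq x <- r | 0 < h x].
    exact: filter_uniq.
  split=> x; rewrite mem_filter; first by move=> /andP[].
  rewrite negb_and => /orP[|/rP //]; rewrite -leNgt => hx.
  by apply/eqP; rewrite eq_le hx h0.
move: {2}(size r) (leqnn (size r)) => n; elim: n => [|n IH] in h h0 fh r Ur rpos rout *.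
  rewrite leqn0 size_eq0 => /eqP r0.
  have h_eq0 x : h x = 0 by apply: rout; rewrite r0.
  rewrite (@eq_fsum _ _ h (fun=> 0)) // fsum0 mulr0.
  by apply: sumr_ge0 => i _; apply: fsum_ge0 => x; rewrite le_max lexx orbT.
move=> rn; case: (eqVneq r [::]) => [r0|rn0].
  by apply: (IH h h0 fh r) => //; rewrite r0.
have [x0 x0r x0min] : exists2 x0, x0 \in r & forall x, x \in r -> h x0 <= h x.
  elim: r rn0 {Ur rpos rout rn} => // y [|z s] IHs _.
    by exists y; rewrite ?mem_head // => x; rewrite inE => /eqP ->.
  have [x1 x1s x1min] := IHs isT.
  have [hy|hy] := leP (h y) (h x1).
    exists y; rewrite ?mem_head // => x; rewrite inE => /predU1P[->//|/x1min].
    exact: le_trans.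
  exists x1; first by rewrite inE x1s orbT.
  by move=> x; rewrite inE => /predU1P[->|/x1min //]; exact: ltW.
pose t := h x0; have t0 : 0 < t by exact: rpos.
pose h' x := h x - t * indicator r x.
have hE x : h x = t * indicator r x + h' x by rewrite /h' addrC subrK.
have h'0 x : 0 <= h' x.
  rewrite /h' /indicator; case: (boolP (x \in r)) => xr; last by rewrite mulr0 subr0.
  by rewrite mulr1 subr_ge0; exact: x0min.
have h'out x : x \notin r -> h' x = 0.
  by move=> xr; rewrite /h' /indicator rout // (negPf xr) mulr0 subrr.
have fh' : fin_supp h' by exists r.
have fi := fin_supp_indicator r.
have -> : fsum h = t * fsum (indicator r) + fsum h'.
  by rewrite -fsumZ -fsumD //; [exact: eq_fsum | exact: fin_suppMl].
have -> : sum_pos_part (edge_diff h) = t * sum_pos_part (edge_diff (indicator r)) + sum_pos_part (edge_diff h').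
  rewrite /sum_pos_part mulr_sumr -big_split; apply: eq_bigr => i _ /=.
  rewrite -fsumZ -fsumD.
  - apply: eq_fsum => x; rewrite /edge_diff !hE /indicator.
    have := h'0 x; have := h'0 (e i * x)%g; have := h'out x; have := h'out (e i * x)%g.
    case: (x \in r); case: ((e i * x)%g \in r) => /= hy hx h'y h'x;
      rewrite ?(hx isT) ?(hy isT) ?mulr1 ?mulr0 !maxEle; do ?[case: leP => ?]; lra.
  - exact/fin_suppMl/finite_vec_max/finite_vec_edge_diff.
  - exact/finite_vec_max/finite_vec_edge_diff.
rewrite mulrDr; apply: lerD.
  by rewrite fsum_indicator // mulrCA ler_wpM2l ?isop // ltW.
pose r' := [seq x <- r | 0 < h' x].
apply: (IH h' h'0 fh' r').
- exact: filter_uniq.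
- by move=> x; rewrite mem_filter => /andP[].
- move=> x; rewrite mem_filter negb_and => /orP[|/h'out //]; rewrite -leNgt => hx.
  by apply/eqP; rewrite eq_le hx h'0.
- rewrite -ltnS; apply: leq_trans rn; rewrite size_filter.
  rewrite -[leqRHS](count_predC (fun x => 0 < h' x)) -addn1 leq_add2l -has_count.
  by apply/hasP; exists x0 => //=; rewrite /h' /indicator x0r mulr1 subrr ltxx.
Qed.

(** A strong isoperimetric inequality yields a field on the edges with values
    in [0, 1] and divergence at least [eps].  By [coarea] the infimum over
    [h >= 0] of [sum_pos_part (u + edge_diff h) - eps * fsum h] is a sublinear
    function of [u]; a linear functional below it is such a field, as one sees
    by evaluating it at the vectors [delta], at their opposites, and at
    [- edge_diff h] for [h] the indicator of a point. *)
Lemma bounded_field (eps : R) : 0 < eps ->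
  (forall F : seq Q, uniq F -> eps * (size F)%:R <= sum_pos_part (edge_diff (indicator F))) ->
  exists phi : vec, (forall i x, 0 <= phi i x <= 1) /\
    forall x, eps <= \sum_i (phi i x - phi i ((e i)^-1 * x)%g).
Proof.
move=> eps0 isop; have co := coarea isop.
pose A : set (Q -> R) := [set h | (forall x, 0 <= h x) /\ fin_supp h].
pose Phi h (u : vec) := sum_pos_part (lincomb 1 u (edge_diff h)) - eps * fsum h.
have A0 : A (fun=> 0) by split=> //; exact: fin_supp0.
have edge_diff0 : edge_diff (fun=> 0) = (fun _ _ => 0).
  by apply/funext => i; apply/funext => x; rewrite /edge_diff subrr.
have lincomb10 (u : vec) : lincomb 1 u (fun _ _ => 0) = u.
  by apply/funext => i; apply/funext => x; rewrite /lincomb mul1r addr0.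
have Phi0 u : Phi (fun=> 0) u = sum_pos_part u by rewrite /Phi edge_diff0 lincomb10 fsum0 mulr0 subr0.
have sp := sublin_sum_pos_part; have finite_vec0' := @finite_vec0 R Q 'I_k.
have [|||qs qle] := @sublin_inf R Q 'I_k _ A Phi.
- by exists (fun=> 0) => //; rewrite Phi0; exact: sp.1.
- move=> u fu; exists (- sum_pos_part (lincomb (-1) u (fun _ _ => 0))) => h [h0 fh].
  have fb := finite_vec_edge_diff fh; have := co h h0 fh.
  have := sp.2 1 (lincomb 1 u (edge_diff h)) (lincomb (-1) u (fun _ _ => 0)) ler01
    (finite_vec_lincomb _ fu fb) (finite_vec_lincomb _ fu finite_vec0').
  have -> : lincomb 1 (lincomb 1 u (edge_diff h)) (lincomb (-1) u (fun _ _ => 0)) = edge_diff h.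
    by apply/funext => i; apply/funext => x; rewrite /lincomb; ring.
  rewrite /Phi; lra.
- move=> a u v h h' a0 fu fv [h0 fh] [h'0 fh'].
  exists (fun x => a * h x + h' x).
    split; first by move=> x; rewrite addr_ge0 // mulr_ge0 // ltW.
    by apply: fin_suppD => //; exact: fin_suppMl.
  rewrite /Phi fsumD ?fsumZ //; last exact: fin_suppMl.
  have := sp.2 a (lincomb 1 u (edge_diff h)) (lincomb 1 v (edge_diff h')) (ltW a0)
    (finite_vec_lincomb _ fu (finite_vec_edge_diff fh)) (finite_vec_lincomb _ fv (finite_vec_edge_diff fh')).
  rewrite (_ : lincomb a _ _ = lincomb 1 (lincomb a u v) (edge_diff (fun x => a * h x + h' x))).
    by move=> le; nra.
  by apply/funext => i; apply/funext => x; rewrite /lincomb /edge_diff; ring.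
have [phi phiP] := dominated_functional qs.
have phi_le u h : finite_vec u -> A h -> dotp u phi <= sum_pos_part (lincomb 1 u (edge_diff h)) - eps * fsum h.
  by move=> fu Ah; apply: le_trans (phiP u fu) (qle u h fu Ah).
have phi_le0 u : finite_vec u -> dotp u phi <= sum_pos_part u.
  by move=> fu; have := phi_le u _ fu A0; rewrite -/(Phi _ u) Phi0.
have dotp0l w : dotp ((fun _ _ => 0) : vec) w = 0.
  by rewrite /dotp big1 // => j _; rewrite -[RHS](@fsum0 R Q); apply: eq_fsum => y; rewrite mul0r.
exists phi; split=> [i x|x].
  have fd := @finite_vec_delta R Q _ i x; apply/andP; split; last first.
    have := phi_le0 _ fd; rewrite dotp_delta => /le_trans; apply.
    rewrite -[leRHS](dotp_delta i x (fun _ _ => 1)) le_eqVlt; apply/orP; left; apply/eqP.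
    apply: eq_bigr => j _; apply: eq_fsum => y; rewrite mulr1 max_l //.
  have := phi_le0 (lincomb (-1) (delta i x) (fun _ _ => 0)) (finite_vec_lincomb _ fd finite_vec0').
  rewrite dotp_lincomb // dotp_delta dotp0l addr0 mulN1r (_ : sum_pos_part _ = 0) ?oppr_le0 //.
  rewrite /sum_pos_part big1 // => j _; rewrite -[RHS](@fsum0 R Q); apply: eq_fsum => y.
  by rewrite max_r // /lincomb addr0 mulN1r oppr_le0 /delta ler0n.
have Ax : A (indicator [:: x]) by split=> [y|]; [exact: ler0n | exact: fin_supp_indicator].
have := phi_le (lincomb (-1) (edge_diff (indicator [:: x])) (fun _ _ => 0)) _
  (finite_vec_lincomb _ (finite_vec_edge_diff Ax.2) finite_vec0') Ax.
rewrite fsum_indicator // mulr1 dotp_lincomb //; last exact: finite_vec_edge_diff Ax.2.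
rewrite dotp0l addr0 mulN1r (_ : lincomb 1 _ _ = (fun _ _ => 0)); last first.
  by apply/funext => i; apply/funext => y; rewrite /lincomb; ring.
rewrite (sublin_zero sp) sub0r lerN2 => /le_trans; apply.
rewrite le_eqVlt; apply/orP; left; apply/eqP; apply: eq_bigr => i _.
have -> : (fun y => edge_diff (indicator [:: x]) i y * phi i y) = (fun y =>
    indicator [:: x] y * phi i y + -1 * (indicator [:: ((e i)^-1 * x)%g] y * phi i y)).
  apply/funext => y; rewrite /edge_diff /indicator !inE.
  have -> : ((e i * y)%g == x) = (y == ((e i)^-1 * x)%g).
    by rewrite -(inj_eq (mulgI (e i)^-1%g)) mulKg.
  by ring.
have f1 z : fin_supp (fun y => indicator [:: z] y * phi i y).
  exact/fin_suppMr/fin_supp_indicator.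
have s1 z : fsum (fun y => indicator [:: z] y * phi i y) = phi i z.
  rewrite (@fsumE _ _ [:: z]) // => [|y /negPf yz]; last by rewrite /indicator yz mul0r.
  by rewrite big_seq1 /indicator mem_head mul1r.
by rewrite fsumD ?fsumZ ?s1 ?mulN1r //; exact: fin_suppMl.
Qed.

End AmenableFolner.

Section TrivialGroup.

Let op (_ _ : unit) := tt.
Let assoc : associative op. Proof. by []. Qed.
Let left1 : left_id tt op. Proof. by case. Qed.
Let right1 : right_id tt op. Proof. by case. Qed.
Let invl : left_inverse tt id op. Proof. by []. Qed.
Let invr : right_inverse tt id op. Proof. by []. Qed.

HB.instance Definition _ := isGroup.Build unit assoc left1 right1 invl invr.

End TrivialGroup.

Section Amenable.
Variable R : realType.
Notation AEP := (@algebraic_eigenvalue_property R).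

Lemma bounded_funP (T : Type) (f : T -> R) K : (forall x, `|f x| <= K) -> bounded_fun f.
Proof.
by move=> fK; exists K; split; [exact: num_real | move=> M KM x _; exact: le_trans (fK x) (ltW KM)].
Qed.

(** The mean of the divergence of a bounded field is 0 by invariance. *)
Theorem amenable_folner (Q : groupType) : amenable R Q -> folner R Q.
Proof.
move=> [m [mlin mpos m1 minv]] E eps eps0; apply: contrapT => noF.
pose e (i : 'I_(size E)) := nth 1%g E i.
have [F UF|phi [phi01 divphi]] := @bounded_field R Q _ e eps eps0.
  have [F0|F0] := posnP (size F).
    rewrite F0 mulr0; apply: sumr_ge0 => i _; apply: fsum_ge0 => x.
    by rewrite le_max lexx orbT.
  have lt : eps * (size F)%:R <
      (count (fun q => ~~ all (fun e => (e * q)%g \in F) E) F)%:R.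
    by rewrite ltNge; apply/negP => le; apply: noF; exists F.
  apply: le_trans (ltW lt) _; rewrite /sum_pos_part.
  have -> : \sum_i fsum (fun x => Num.max (edge_diff e (indicator R F) i x) 0) =
      \sum_(x <- F) \sum_i ((e i * x)%g \notin F)%:R :> R.
    rewrite exchange_big; apply: eq_bigr => i _.
    rewrite (fsumE UF) => [|x /negPf xF].
      rewrite big_seq [RHS]big_seq; apply: eq_bigr => x xF; rewrite /edge_diff /indicator xF.
      by case: (_ \in F); rewrite ?subrr ?maxxx // subr0 max_l ?ler01.
    by rewrite /edge_diff /indicator xF sub0r max_r // oppr_le0 ler0n.
  rewrite -sum1_count natr_sum big_mkcond; apply: ler_sum => x _.
  case: ifP => [/allPn[e' e'E e'x]|_]; last by apply: sumr_ge0 => i _; exact: ler0n.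
  have iE : (index e' E < size E)%N by rewrite index_mem.
  rewrite (bigD1 (Ordinal iE)) //= /e /= nth_index // e'x lerDl.
  by apply: sumr_ge0 => i _; exact: ler0n.
have bphi i : bounded_fun (phi i).
  by apply: (@bounded_funP _ _ 1) => x; have /andP[p0 p1] := phi01 i x; rewrite ger0_norm.
have bphie i : bounded_fun (fun x => phi i ((e i)^-1 * x)%g).
  apply: (@bounded_funP _ _ 1) => x.
  by have /andP[p0 p1] := phi01 i ((e i)^-1 * x)%g; rewrite ger0_norm.
have b1 c : bounded_fun (fun _ : Q => c : R) by exact: (@bounded_funP _ _ `|c|).
have bD (a : R) (f h : Q -> R) : bounded_fun f -> bounded_fun h ->
    bounded_fun (fun x => a * f x + h x).
  move=> [K [_ fK]] [L [_ hL]].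
  apply: (@bounded_funP _ _ (`|a| * (K + 1) + (L + 1))) => x.
  apply: le_trans (ler_normD _ _) _; rewrite normrM; apply: lerD.
    by rewrite ler_wpM2l ?normr_ge0 //; apply: fK => //; rewrite ltrDl.
  by apply: hL => //; rewrite ltrDl.
have m0 : m (fun=> 0) = 0.
  have := mlin (-1) (fun=> 0) (fun=> 0) (b1 0) (b1 0).
  have -> : (fun _ : Q => -1 * 0 + 0) = (fun=> 0) :> (Q -> R).
    by apply/funext => x; rewrite mulr0 addr0.
  by rewrite mulN1r addNr.
pose D (s : seq 'I_(size E)) x := \sum_(i <- s) (phi i x - phi i ((e i)^-1 * x)%g).
have mD s : bounded_fun (D s) /\ m (D s) = 0.
  elim: s => [|i s [bs ms]].
    by rewrite (_ : D [::] = fun=> 0) //; apply/funext => x; rewrite /D big_nil.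
  have -> : D (i :: s) = (fun x => 1 * phi i x + (-1 * phi i ((e i)^-1 * x)%g + D s x)).
    by apply/funext => x; rewrite /D big_cons; ring.
  split; first by apply: (bD) => //; exact: bD.
  by rewrite !mlin // ?ms ?minv //; [ring | exact: bD].
have [bDD mDD] := mD (index_enum _).
have : 0 <= m (fun x => - eps * 1 + D (index_enum _) x).
  apply: mpos; first exact: bD.
  by move=> x; rewrite mulr1 addrC subr_ge0; exact: divphi.
by rewrite mlin // mDD m1 mulr1 addr0 oppr_ge0 leNgt eps0.
Qed.

Theorem amenable_aep (G : groupType) : amenable R G -> AEP G.
Proof.
move=> /amenable_folner folG.
have idM : {morph (fun x : G => x) : x y / (x * y)%g} by [].
have oneM : {morph (fun _ : unit => 1%g : G) : x y / (x * y)%g}.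
  by move=> x y; rewrite mulg1.
apply: (aep_folner_extension (N := unit) _ _ folG).
  by apply: aep_trivial => -[].
exists (mkmorph oneM), (mkmorph idM); split=> [[] []||g] //=.
  by move=> q; exists q.
by split=> [->|[_ <-]] //; exists tt.
Qed.

End Amenable.

(** * Cuts and flows in the Cayley graph of a free group *)

Section LampGroup.
Variable G : groupType.

(** The semidirect product of the functions [G -> bool] by [G].  A morphism
    from [G] that lifts the identity is a cocycle with values in these
    functions, so the universal property of a free group yields cocycles with
    prescribed values on the generators. *)
Definition lamp : Type := ((G -> bool) * G)%type.
HB.instance Definition _ := Choice.on lamp.

Let mul (p q : lamp) : lamp := (fun x => q.1 x (+) p.1 (q.2 * x)%g, (p.2 * q.2)%g).
Let one : lamp := (fun=> false, 1%g).
Let inv (p : lamp) : lamp := (fun x => p.1 (p.2^-1 * x)%g, p.2^-1%g).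

Let mulA : associative mul.
Proof.
move=> [a g] [b h] [c k]; congr (_, _) => /=; last by rewrite mulgA.
by apply/funext => x; rewrite addbA mulgA.
Qed.
Let mul1 : left_id one mul.
Proof. by move=> [a g]; congr (_, _); rewrite /= ?mul1g //; apply/funext => x; rewrite addbF. Qed.
Let mulr1 : right_id one mul.
Proof. by move=> [a g]; congr (_, _); rewrite /= ?mulg1 //; apply/funext => x; rewrite mul1g. Qed.
Let mulV : left_inverse one inv mul.
Proof.
by move=> [a g]; congr (_, _); rewrite /= ?mulVg //; apply/funext => x; rewrite mulKg addbb.
Qed.
Let mulrV : right_inverse one inv mul.
Proof. by move=> [a g]; congr (_, _); rewrite /= ?mulgV //; apply/funext => x; rewrite addbb. Qed.

HB.instance Definition _ := isGroup.Build lamp mulA mul1 mulr1 mulV mulrV.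

Lemma lampM1 (p q : lamp) x : (p * q)%g.1 x = q.1 x (+) p.1 (q.2 * x)%g.
Proof. by []. Qed.

End LampGroup.

Section FreeGroup.
Variables (G : groupType) (S : set G).

Definition free_on : Prop := forall (H : groupType) (u : G -> H),
  exists f : {multiplicative G -> H},
    (forall s, S s -> f s = u s) /\
    (forall f' : {multiplicative G -> H}, (forall s, S s -> f' s = u s) -> forall g, f' g = f g).

Hypothesis freeG : free_on.

Lemma free_unique (H : groupType) (f f' : {multiplicative G -> H}) :
  (forall s, S s -> f s = f' s) -> forall g, f g = f' g.
Proof.
move=> ff' g; have [f0 [_ f0P]] := freeG f'.
by rewrite (f0P f) // (f0P f').
Qed.

(** Removing the edge from [g0] to [s0 * g0] disconnects the Cayley graph: [c]
    is one of the two sides.  It is read off a morphism to the lamp group that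
    switches a lamp for that edge only. *)
Lemma free_cut s0 g0 : S s0 -> exists c : G -> bool,
  forall s g, S s -> c (s * g)%g = c g (+) ((g == g0) && (s == s0)).
Proof.
move=> Ss0; have [f [fS _]] := freeG (fun g => (fun x => (x == g0) && (g == s0), g) : lamp G).
have f2 g : (f g).2 = g.
  have sM : {morph (fun g => (f g).2) : x y / (x * y)%g} by move=> x y; rewrite gmulfM.
  have iM : {morph (fun x : G => x) : x y / (x * y)%g} by [].
  by apply: (free_unique (f := mkmorph sM) (f' := mkmorph iM)) => s /= /fS ->.
exists (fun g => (f g).1 1%g) => s g Ss.
by rewrite gmulfM lampM1 f2 (fS s Ss) /= mulg1.
Qed.

(** Conjugation by the indicator of [P] and the plain embedding are two
    morphisms to the lamp group which agree on the generators. *)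
Lemma free_generated (P : G -> Prop) :
  P 1%g -> (forall s g, S s -> P (s * g)%g <-> P g) -> forall g, P g.
Proof.
move=> P1 PS g; pose p x := `[< P x >].
have f1M : {morph (fun g => (fun=> false, g) : lamp G) : x y / (x * y)%g} by [].
have f2M : {morph (fun g => (fun x => p (g * x)%g (+) p x, g) : lamp G) : x y / (x * y)%g}.
  move=> x y; congr (_, _); apply/funext => z /=; rewrite mulgA.
  by case: (p _); case: (p _); case: (p _).
have E := @free_unique _ (mkmorph f1M) (mkmorph f2M).
have /(congr1 (fun q : lamp G => q.1 1%g)) /= : mkmorph f1M g = mkmorph f2M g.
  apply: E => s Ss; congr (_, _); apply/funext => x /=.
  suff -> : p (s * x)%g = p x by rewrite addbb.
  by apply: asbool_equiv_eq; exact: PS.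
rewrite mulg1 (_ : p 1%g = true); last exact/asboolP.
by case pg : (p g) => // _; exact/asboolP.
Qed.

End FreeGroup.

Section Flows.
Variables (R : realType) (G : groupType).

Definition l1_le (h : G -> R) (K : R) : Prop :=
  forall r, uniq r -> \sum_(x <- r) `|h x| <= K.

Lemma l1_le_tail h K eta : l1_le h K -> 0 < eta -> exists r0 : seq G,
  forall r, uniq r -> (forall x, x \in r -> x \notin r0) -> \sum_(x <- r) `|h x| <= eta.
Proof.
move=> hK eta0.
pose A : set R := [set y | exists2 r, uniq r & y = \sum_(x <- r) `|h x|].
have supA : has_sup A.
  by split; [exists 0, [::]; rewrite ?big_nil | exists K => _ [r Ur ->]; exact: hK].
have [_ [r0 Ur0 ->] r0P] := sup_adherent eta0 supA.
exists r0 => r Ur rr0.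
have Urr : uniq (r ++ r0).
  rewrite cat_uniq Ur Ur0 andbT /=; apply/hasPn => x xr0; apply/negP => /rr0.
  by rewrite xr0.
have : \sum_(x <- r ++ r0) `|h x| <= sup A by apply: sup_upper_bound => //; exists (r ++ r0).
by rewrite big_cat /=; lra.
Qed.

Lemma l1_le_tail_seq (I : eqType) (T : seq I) (h : I -> G -> R) eta :
  (forall s, exists K, l1_le (h s) K) -> 0 < eta -> exists r0 : seq G,
  forall s r, s \in T -> uniq r -> (forall x, x \in r -> x \notin r0) ->
    \sum_(x <- r) `|h s x| <= eta.
Proof.
move=> hl1 eta0; elim: T => [|s T [r0 IH]]; first by exists [::].
have [K hK] := hl1 s; have [r1 r1P] := l1_le_tail hK eta0.
exists (r0 ++ r1) => s' r; rewrite inE => /predU1P[->|s'T] Ur rP.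
  by apply: r1P => // x /rP; rewrite mem_cat negb_or => /andP[].
by apply: IH => // x /rP; rewrite mem_cat negb_or => /andP[].
Qed.

(** On the graph with edges from [g] to [s * g], consider an absolutely summable
    flow without sources, and an edge whose removal disconnects the graph.
    Pairing the divergence of the flow with the indicator of one side leaves
    only the flow through that edge, up to the summation by parts at the
    boundary of a large finite set [F]; these errors are small because they
    involve the flow outside [r0]. *)
Lemma flow_zero (T : seq G) (phi : G -> G -> R) (c : G -> bool) s0 g0 :
  uniq T -> (forall s, exists K, l1_le (phi s) K) ->
  (forall g, \sum_(s <- T) (phi s g - phi s (s^-1 * g)%g) = 0) ->
  s0 \in T ->
  (forall s g, s \in T -> c (s * g)%g = c g (+) ((g == g0) && (s == s0))) ->
  phi s0 g0 = 0.
Proof.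
move=> UT phil1 div0 s0T cut.
suff small eta : 0 < eta -> `|phi s0 g0| <= (size T)%:R * (2 * eta).
  apply/eqP; rewrite -normr_le0 leNgt; apply/negP => pos.
  have T0 : 0 < (size T)%:R :> R by rewrite ltr0n; case: (T) s0T.
  have := small (`|phi s0 g0| / (4 * (size T)%:R)).
  rewrite divr_gt0 // ?mulr_gt0 // => /(_ isT).
  rewrite (_ : _ * (2 * _) = `|phi s0 g0| / 2); last by field; rewrite gt_eqF.
  lra.
move=> eta0; have [r0 r0P] := l1_le_tail_seq T phil1 eta0.
pose core := g0 :: r0.
pose F := undup (core ++ [seq (s * x)%g | s <- T, x <- core]).
have UF : uniq F by exact: undup_uniq.
have coreF x : x \in core -> x \in F by move=> xc; rewrite mem_undup mem_cat xc.
have coreFs s x : s \in T -> x \in core -> (s * x)%g \in F.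
  by move=> sT xc; rewrite mem_undup mem_cat orbC; apply/orP; left; apply/allpairsP; exists (s, x).
pose Fs s := [seq (s^-1 * x)%g | x <- F].
have UFs s : uniq (Fs s) by rewrite map_inj_uniq //; exact: mulgI.
have memFs s x : (x \in Fs s) = ((s * x)%g \in F).
  by rewrite -[x in LHS](mulKg s) mem_map //; exact: mulgI.
pose err s := \sum_(x <- F | x \notin Fs s) (c x)%:R * phi s x -
              \sum_(x <- Fs s | x \notin F) (c (s * x)%g)%:R * phi s x.
have err_le s : s \in T -> `|err s| <= 2 * eta.
  move=> sT; apply: le_trans (ler_normB _ _) _.
  have part (b : G -> bool) (r : seq G) (P : pred G) : uniq r ->
      (forall x, x \in r -> P x -> x \notin r0) ->
      `|\sum_(x <- r | P x) (b x)%:R * phi s x| <= eta.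
    move=> Ur rP; apply: le_trans (ler_norm_sum _ _ _) _.
    apply: (@le_trans _ _ (\sum_(x <- r | P x) `|phi s x|)).
      by apply: ler_sum => x _; rewrite normrM; case: (b x); rewrite ?normr1 ?normr0 ?mul1r ?mul0r.
    rewrite -big_filter; apply: r0P => //; first exact: filter_uniq.
    by move=> x; rewrite mem_filter => /andP[Px xr]; exact: rP.
  have -> : 2 * eta = eta + eta by ring.
  apply: lerD.
    apply: (part c) => // x xF; rewrite memFs; apply: contra => xr.
    by apply: coreFs; rewrite ?inE ?xr ?orbT.
  apply: (part (fun x => c (s * x)%g)) => // x _; apply: contra => xr.
  by apply: coreF; rewrite inE xr orbT.
have main s : s \in T -> \sum_(x <- F) (c x)%:R * (phi s x - phi s (s^-1 * x)%g) =
    (s == s0)%:R * (((c g0)%:R - (~~ c g0)%:R) * phi s0 g0) + err s.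
  move=> sT.
  under eq_bigr do rewrite mulrBr.
  rewrite sumrB.
  have -> : \sum_(x <- F) (c x)%:R * phi s (s^-1 * x)%g =
      \sum_(x <- Fs s) (c (s * x)%g)%:R * phi s x.
    by rewrite big_map; apply: eq_bigr => x _; rewrite mulVKg.
  rewrite (bigID (mem (Fs s))) /= [X in _ - X](bigID (mem F)) /= /err.
  have -> : \sum_(x <- Fs s | x \in F) (c (s * x)%g)%:R * phi s x =
      \sum_(x <- F | x \in Fs s) (c (s * x)%g)%:R * phi s x.
    rewrite -big_filter -[RHS]big_filter; apply: perm_big; apply: uniq_perm.
    - exact: filter_uniq.
    - exact: filter_uniq.
    - by move=> x; rewrite !mem_filter andbC.
  set A := \sum_(x <- F | x \in Fs s) _; set B := \sum_(x <- F | x \notin Fs s) _.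
  set A' := \sum_(x <- F | x \in Fs s) _; set B' := \sum_(x <- Fs s | x \notin F) _.
  suff <- : A - A' = (s == s0)%:R * (((c g0)%:R - (~~ c g0)%:R) * phi s0 g0) by ring.
  have memg0 : g0 \in [seq x <- F | x \in Fs s].
    by rewrite mem_filter memFs coreFs ?coreF ?mem_head.
  rewrite -sumrB -big_filter (bigD1_seq g0) ?filter_uniq //= big1 => [|x xg0].
    rewrite addr0 cut // eqxx /=; case: eqP => [->|_]; last by rewrite addbF subrr mul0r.
    by rewrite addbT mul1r -mulrBl.
  by rewrite cut // (negPf xg0) addbF subrr.
have : \sum_(x <- F) (c x)%:R * \sum_(s <- T) (phi s x - phi s (s^-1 * x)%g) = 0.
  by rewrite big1 // => x _; rewrite div0 mulr0.
under eq_bigr do rewrite mulr_sumr.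
rewrite exchange_big /= big_seq (eq_bigr _ main) -big_seq big_split /=.
rewrite (bigD1_seq s0) //= eqxx mul1r big1 => [|s /negPf ->]; last by rewrite mul0r.
rewrite addr0 => /eqP; rewrite addr_eq0 => /eqP E.
have -> : `|phi s0 g0| = `|((c g0)%:R - (~~ c g0)%:R) * phi s0 g0|.
  by case: (c g0); rewrite ?subr0 ?sub0r ?mul1r // mulN1r normrN.
rewrite E normrN; apply: le_trans (ler_norm_sum _ _ _) _.
rewrite big_seq; apply: (@le_trans _ _ (\sum_(s <- T | s \in T) (2 * eta))).
  by apply: ler_sum.
by rewrite -big_seq big_const_seq count_predT iter_addr_0 [leRHS]mulr_natl.
Qed.

End Flows.

(** * Linear systems over a free group *)

Section LinearSystems.
Variables (R : realType) (G : groupType).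

Lemma left_inverse_of_inj (J K : finType) (t : K -> J -> R) :
  (forall r : J -> R, (forall k, \sum_j t k j * r j = 0) -> forall j, r j = 0) ->
  exists X : J -> K -> R, forall i j, \sum_k X i k * t k j = (i == j)%:R.
Proof.
move=> tinj.
pose A := \matrix_(b < #|J|, a < #|K|) t (enum_val a) (enum_val b).
have /row_freeP[B AB] : row_free A.
  apply: inj_row_free => v vA; apply/rowP => b; rewrite mxE.
  have := tinj (fun j => v 0 (enum_rank j)) _ (enum_val b); rewrite enum_valK; apply.
  move=> k; move/rowP: vA => /(_ (enum_rank k)); rewrite !mxE => E.
  rewrite -[RHS]E [LHS]big_ord_enum; apply: eq_bigr => b' _.
  by rewrite mxE enum_rankK enum_valK mulrC.
exists (fun i k => B (enum_rank k) (enum_rank i)) => i j.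
move/matrixP: AB => /(_ (enum_rank j) (enum_rank i)); rewrite !mxE.
rewrite (inj_eq enum_rank_inj) eq_sym => <-.
rewrite [LHS]big_ord_enum; apply: eq_bigr => a _.
by rewrite mxE !enum_rankK enum_valK mulrC.
Qed.

Variable T : seq G.
Hypothesis UT : uniq T.
Hypothesis cutT : forall s0 g0, s0 \in T -> s0 <> 1%g -> exists c : G -> bool,
  forall s g, s \in T -> c (s * g)%g = c g (+) ((g == g0) && (s == s0)).

Lemma mul_l1_le (I J : finType) (m : I -> J -> R) (w : vec R G I) (v : vec R G J) C C' a b s :
  l2_le w C -> l2_le v C' ->
  l1_le (fun g => \sum_i \sum_j m i j * w i (s * g * a)%g * v j (g * b)%g)
      (\sum_i \sum_j `|m i j| * (C + C')).
Proof.
move=> wC vC r Ur.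
apply: (@le_trans _ _ (\sum_(g <- r) \sum_i \sum_j
    `|m i j| * (w i (s * g * a)%g ^+ 2 + v j (g * b)%g ^+ 2))).
  apply: ler_sum => g _; apply: le_trans (ler_norm_sum _ _ _) _; apply: ler_sum => i _.
  apply: le_trans (ler_norm_sum _ _ _) _; apply: ler_sum => j _.
  rewrite -mulrA normrM ler_wpM2l // ler_norml; set x := w _ _; set y := v _ _.
  have := sqr_ge0 (x + y); have := sqr_ge0 (x - y).
  have := sqr_ge0 x; have := sqr_ge0 y; rewrite !expr2 => *; apply/andP; split; lra.
rewrite exchange_big; apply: ler_sum => i _; rewrite exchange_big; apply: ler_sum => j _ /=.
rewrite -mulr_sumr ler_wpM2l // big_split /=; apply: lerD.
  have Us : uniq [seq (s * g * a)%g | g <- r].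
    by rewrite map_inj_uniq // => x y /mulIg /mulgI.
  have := wC _ Us; rewrite (bigD1 i) //= big_map; apply: le_trans; rewrite lerDl.
  by do 2![apply: sumr_ge0 => ? _]; exact: sqr_ge0.
have Us : uniq [seq (g * b)%g | g <- r] by rewrite map_inj_uniq //; exact: mulIg.
have := vC _ Us; rewrite (bigD1 j) //= big_map; apply: le_trans; rewrite lerDl.
by do 2![apply: sumr_ge0 => ? _]; exact: sqr_ge0.
Qed.

(** Let [v] solve a system and [w] the transposed one.  Multiplying one system
    by [w] and the other by [v] and subtracting shows that the functions
    [g |-> psi s (s g a) (g b)] form a flow without sources.  It vanishes, and
    the sum over [s] of the [psi s x y] is [w x . v y] when the coefficients
    add up to the identity. *)
Lemma kernels_orthogonal (J : finType) (M : G -> J -> J -> R) v w C C' :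
  (forall i j, \sum_(g <- T) M g i j = (i == j)%:R) ->
  l2_le v C -> l2_le w C' -> convop T M v = (fun _ _ => 0) ->
  convop (inv_seq T) (transp M) w = (fun _ _ => 0) ->
  forall x y, \sum_i w i x * v i y = 0.
Proof.
move=> tot vC wC Mv Mw.
pose psi s x y := \sum_i \sum_j M s i j * w i x * v j y.
have E1 x y : \sum_(s <- T) psi s (s * x)%g y = 0.
  rewrite (_ : \sum_(s <- T) _ = \sum_j (convop (inv_seq T) (transp M) w j x) * v j y); last first.
    under [RHS]eq_bigr do rewrite convop_tr mulr_suml.
    rewrite [RHS]exchange_big; apply: eq_bigr => s _; rewrite /psi exchange_big.
    by apply: eq_bigr => j _; rewrite mulr_suml.
  by rewrite Mw big1 // => j _; rewrite mul0r.
have E2 x y : \sum_(s <- T) psi s x (s^-1 * y)%g = 0.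
  rewrite (_ : \sum_(s <- T) _ = \sum_i w i x * convop T M v i y); last first.
    under [RHS]eq_bigr do rewrite /convop mulr_sumr.
    rewrite [RHS]exchange_big; apply: eq_bigr => s _; rewrite /psi.
    apply: eq_bigr => i _; rewrite mulr_sumr; apply: eq_bigr => j _; ring.
  by rewrite Mv big1 // => j _; rewrite mulr0.
have psi0 s : s \in T -> s <> 1%g -> forall x y, psi s x y = 0.
  move=> sT s1 x y; have [c cP] := cutT 1%g sT s1.
  (* the shifts are chosen so that the flow at 1 along [s] is [psi s x y] *)
  have := @flow_zero R G T (fun s' g => psi s' (s' * g * (s^-1 * x))%g (g * y)%g) c s 1%g UT.
  rewrite mulg1 mul1g mulVKg; apply=> //.
  - move=> s'; eexists; exact: mul_l1_le wC vC.
  - move=> g; rewrite sumrB.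
    have -> : \sum_(s' <- T) psi s' (s' * g * (s^-1 * x))%g (g * y)%g = 0.
      apply: etrans (E1 (g * (s^-1 * x))%g (g * y)%g).
      by apply: eq_bigr => s' _; rewrite !mulgA.
    have -> : \sum_(s' <- T) psi s' (s' * (s'^-1 * g) * (s^-1 * x))%g (s'^-1 * g * y)%g = 0.
      apply: etrans (E2 (g * (s^-1 * x))%g (g * y)%g).
      by apply: eq_bigr => s' _; rewrite mulVKg !mulgA.
    by rewrite subrr.
have {}psi0 s : s \in T -> forall x y, psi s x y = 0.
  have [->|/eqP s1] := eqVneq s 1%g; last by move=> sT; exact: psi0.
  move=> T1 x y; apply: etrans (E2 x y).
  rewrite (bigD1_seq 1%g) //= invg1 mul1g big_seq_cond big1 ?addr0 // => s' /andP[s'T /eqP].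
  by move=> s'1; exact: psi0.
move=> x y; have : \sum_(s <- T) psi s x y = 0.
  by rewrite big_seq big1 // => s sT; exact: psi0.
move=> E; apply: etrans E; rewrite /psi [RHS]exchange_big; apply: eq_bigr => i _ /=.
rewrite exchange_big (bigD1 i) //= [X in _ + X]big1 => [|j /negPf ji].
  by rewrite addr0; under [RHS]eq_bigr do rewrite -mulrA; rewrite -mulr_suml tot eqxx mul1r.
under eq_bigr do rewrite -mulrA.
by rewrite -mulr_suml tot eq_sym ji mul0r.
Qed.

(** Induction on the number of unknowns.  A left inverse of the sum of the
    coefficients makes the system square with sum 1; a solution [w] of the
    transposed system, evaluated at a point, then gives a linear relation
    between the unknowns, through which one of them is eliminated. *)
Lemma linear_system (n : nat) : forall (K J : finType) (M : G -> K -> J -> R),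
  #|J| = n ->
  (forall r : J -> R, (forall k, \sum_(g <- T) \sum_j M g k j * r j = 0) -> forall j, r j = 0) ->
  forall v C, l2_le v C -> convop T M v = (fun _ _ => 0) -> v = (fun _ _ => 0).
Proof.
elim: n => [|n IH] K J M cardJ Minj v C vC Mv.
  by apply/funext => j; have := card0_eq cardJ j.
apply: contrapT => v0.
have [X XP] : exists X : J -> K -> R, forall i j,
    \sum_k X i k * (\sum_(g <- T) M g k j) = (i == j)%:R.
  apply: left_inverse_of_inj => r rP; apply: Minj => k.
  apply: etrans (rP k); rewrite exchange_big; apply: eq_bigr => j _.
  by rewrite mulr_suml.
pose M1 g i j := \sum_k X i k * M g k j.
have tot1 i j : \sum_(g <- T) M1 g i j = (i == j)%:R.
  rewrite -XP exchange_big; apply: eq_bigr => k _ /=; by rewrite mulr_sumr.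
have M1v : convop T M1 v = (fun _ _ => 0).
  apply/funext => i; apply/funext => x.
  rewrite (_ : convop T M1 v i x = \sum_k X i k * convop T M v k x).
    by rewrite Mv big1 // => k _; rewrite mulr0.
  rewrite /convop; under [RHS]eq_bigr do rewrite mulr_sumr.
  rewrite [RHS]exchange_big; apply: eq_bigr => g _ /=.
  under [RHS]eq_bigr do rewrite mulr_sumr.
  rewrite [RHS]exchange_big; apply: eq_bigr => j _ /=.
  by rewrite /M1 mulr_suml; apply: eq_bigr => k _; rewrite mulrA.
have [w [C' [wC M1w w0]]] : exists w C', [/\ l2_le w C',
    convop (inv_seq T) (transp M1) w = (fun _ _ => 0) & w <> (fun _ _ => 0)].
  by apply: (@kernel_transpose R G J J (inv_seq T) (transp M1) v C) => //; rewrite inv_seqK transpK.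
have orth := kernels_orthogonal tot1 vC wC M1v M1w.
have [k0 [x0 wk0]] : exists k0 x0, w k0 x0 != 0.
  apply: contrapT => wz; apply: w0; apply/funext => k; apply/funext => x.
  by apply: contrapT => /eqP wkx; apply: wz; exists k, x.
pose J' : finType := {j : J | j != k0}.
pose gam (j : J') := - (w (val j) x0 / w k0 x0).
have split_sum (F : J -> R) : \sum_j F j = F k0 + \sum_(j : J') F (val j).
  by rewrite (bigD1 k0) //= (big_sub [pred j | j != k0]).
have vk0 y : v k0 y = \sum_(j : J') gam j * v (val j) y.
  have := orth x0 y; rewrite split_sum => /eqP; rewrite addr_eq0 => /eqP E.
  apply: (mulfI wk0); rewrite E mulr_sumr -sumrN; apply: eq_bigr => j _.
  by rewrite /gam; field.
pose M' g k (j : J') := M g k (val j) + M g k k0 * gam j.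
have sumM' g k (r : J -> R) (r' : J' -> R) : (forall j, r (val j) = r' j) ->
    r k0 = \sum_j gam j * r' j -> \sum_j M' g k j * r' j = \sum_j M g k j * r j.
  move=> rr' rk0; rewrite split_sum rk0 mulr_sumr -big_split; apply: eq_bigr => j _ /=.
  by rewrite /M' rr'; ring.
have v'0 : (fun j : J' => v (val j)) = (fun _ _ => 0).
  apply: (IH K J' M' _ _ _ C).
  - have := cardC1 k0; rewrite cardJ /= => <-; exact: card_sig.
  - move=> r' r'P.
    pose r j := if insub j is Some j' then r' j' else \sum_j gam j * r' j.
    have rval j : r (val j) = r' j by rewrite /r valK.
    have rk0 : r k0 = \sum_j gam j * r' j by rewrite /r insubF // eqxx.
    move=> j; rewrite -rval; apply: Minj => k; rewrite -[RHS](r'P k).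
    by apply: eq_bigr => g _; rewrite (sumM' _ _ r r').
  - move=> s Us; apply: le_trans (vC s Us); rewrite split_sum lerDr.
    by apply: sumr_ge0 => ? _; exact: sqr_ge0.
  - rewrite -Mv; apply/funext => k; apply/funext => x; apply: eq_bigr => g _.
    by rewrite (sumM' _ _ (fun j => v j (g^-1 * x)%g)).
apply: v0; apply/funext => j; apply/funext => x.
have vz (j' : J') y : v (val j') y = 0 by exact: (congr1 (fun f => f j' y) v'0).
have [->|jk] := eqVneq j k0; last exact: (vz (Sub j jk) x).
by rewrite vk0 big1 // => j' _; rewrite vz mulr0.
Qed.

End LinearSystems.

(** * Free groups and the class of Linnell *)

Section FreeInjective.
Variables (R : realType) (G : groupType) (S : set G).
Hypothesis freeG : free_on S.

(** Finite connected sets of vertices of the Cayley graph, phrased through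
    the functions that are constant along the edges. *)
Definition connected_list (W : seq G) : Prop :=
  forall rho : G -> R,
    (forall s h, S s -> h \in W -> (s * h)%g \in W -> rho (s * h)%g = rho h) ->
    forall h, h \in W -> rho h = rho 1%g.

Lemma connected_list_mem g : exists W, [/\ 1%g \in W, g \in W & connected_list W].
Proof.
apply: (free_generated freeG (P := fun g => exists W, [/\ 1%g \in W, g \in W & connected_list W])).
  by exists [:: 1%g]; split; rewrite ?mem_head // => rho _ h; rewrite inE => /eqP ->.
move=> s h Ss; split=> -[W [W1 Wh conn]].
  exists (h :: W); split; rewrite ?inE ?W1 ?eqxx ?orbT // => rho rhoP.
  have rhoW : forall x, x \in W -> rho x = rho 1%g.
    by apply: conn => s' x Ss' xW s'xW; apply: rhoP; rewrite // inE ?xW ?s'xW orbT.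
  move=> x; rewrite inE => /predU1P[->|/rhoW //].
  by rewrite -(rhoW _ Wh); apply/esym/rhoP; rewrite ?inE ?eqxx ?Wh ?orbT.
exists ((s * h)%g :: W); split; rewrite ?inE ?W1 ?eqxx ?orbT // => rho rhoP.
have rhoW : forall x, x \in W -> rho x = rho 1%g.
  by apply: conn => s' x Ss' xW s'xW; apply: rhoP; rewrite // inE ?xW ?s'xW orbT.
move=> x; rewrite inE => /predU1P[->|/rhoW //].
by rewrite -(rhoW _ Wh); apply: rhoP; rewrite ?inE ?eqxx ?Wh ?orbT.
Qed.

Lemma connected_list_sub (T : seq G) :
  exists W, [/\ uniq W, 1%g \in W, {subset T <= W} & connected_list W].
Proof.
suff [W [W1 TW conn]] : exists W, [/\ 1%g \in W, {subset T <= W} & connected_list W].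
  exists (undup W); split; rewrite ?undup_uniq ?mem_undup //.
    by move=> g /TW; rewrite mem_undup.
  move=> rho rhoP h; rewrite mem_undup; apply: conn => s x Ss xW sxW.
  by apply: rhoP; rewrite ?mem_undup.
elim: T => [|g T [W [W1 TW conn]]].
  by exists [:: 1%g]; split; rewrite ?mem_head // => rho _ h; rewrite inE => /eqP ->.
have [W' [W'1 W'g conn']] := connected_list_mem g.
exists (W ++ W'); split; first by rewrite mem_cat W1.
  by move=> h; rewrite inE mem_cat => /predU1P[->|/TW ->//]; rewrite W'g orbT.
move=> rho rhoP h; rewrite mem_cat => /orP[]; [apply: conn|apply: conn'] => s x Ss xW sxW;
  by apply: rhoP; rewrite ?mem_cat ?xW ?sxW ?orbT.
Qed.

Lemma big_pick (I : finType) (T : seq G) g0 (z0 : I) (F : G -> I -> R) : uniq T -> g0 \in T ->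
  \sum_(g <- T) \sum_z ((g == g0) && (z == z0))%:R * F g z = F g0 z0.
Proof.
move=> UT g0T; rewrite (bigD1_seq g0) //= [X in _ + X]big1 => [|g /negPf gg0].
  rewrite addr0 (bigD1 z0) //= big1 => [|z /negPf zz0]; first by rewrite !eqxx mul1r addr0.
  by rewrite zz0 andbF mul0r.
by rewrite big1 // => z _; rewrite gg0 mul0r.
Qed.

(** The unknowns of the linear system are the translates of [v] by the elements
    of a finite connected set [W] that contains the support of [M].  The
    equations are [M v = 0], which involves no group element any more, and
    the relations between translates by the two ends of an edge, which
    involve one generator.  On constant functions the latter identify all
    the translates, as [W] is connected. *)
Theorem free_injective (K J : finType) (T : seq G) (M : G -> K -> J -> R) :
  uniq T -> (forall g, g \notin T -> forall k j, M g k j = 0) ->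
  (forall r : J -> R, (forall k, \sum_(g <- T) \sum_j M g k j * r j = 0) -> forall j, r j = 0) ->
  forall v C, l2_le v C -> convop T M v = (fun _ _ => 0) -> v = (fun _ _ => 0).
Proof.
move=> UT M0 Minj v C vC Mv.
have [W [UW W1 TW conn]] := connected_list_sub T.
pose n := size W; pose w (a : 'I_n) := nth 1%g W a.
have wW a : w a \in W by exact: mem_nth.
have W_w h : h \in W -> exists a, w a = h.
  by move=> /(nthP 1%g)[k kn <-]; exists (Ordinal kn).
have [a1 wa1] := W_w _ W1.
have sumW (F : G -> R) : \sum_(h <- W) F h = \sum_(a : 'I_n) F (w a).
  by rewrite (big_nth 1%g) big_mkord.
pose J0 : finType := ('I_n * J)%type.
pose K0 : finType := (K + 'I_n * 'I_n * J)%type.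
pose edge a b := `[< S (w b / w a)%g >].
pose T0 := undup (1%g :: [seq (w ab.2 / w ab.1)%g | ab <- enum {: 'I_n * 'I_n} & edge ab.1 ab.2]).
have UT0 : uniq T0 by exact: undup_uniq.
have T01 : 1%g \in T0 by rewrite mem_undup mem_head.
have T0S s : s \in T0 -> s = 1%g \/ S s.
  rewrite mem_undup inE => /predU1P[->|/mapP[[a b]]]; first by left.
  by rewrite mem_filter => /andP[/asboolP ? _] ->; right.
have T0edge a b : edge a b -> (w b / w a)%g \in T0.
  move=> ab; rewrite mem_undup inE; apply/orP; right; apply/mapP; exists (a, b) => //.
  by rewrite mem_filter ab mem_enum.
pose M' g (k : K0) (z : J0) : R := match k with
  | inl k => (g == 1%g)%:R * M (w z.1) k z.2
  | inr (a, b, j) => (edge a b)%:R *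
      (((g == 1%g) && (z == (b, j)))%:R - ((g == w b / w a)%g && (z == (a, j)))%:R)
  end.
have M'l k (F : G -> J0 -> R) : \sum_(g <- T0) \sum_z M' g (inl k) z * F g z =
    \sum_(g <- W) \sum_j M g k j * (\sum_(a | w a == g) F 1%g (a, j)).
  rewrite (bigD1_seq 1%g) //= [X in _ + X]big1 => [|g /negPf g1]; last first.
    by rewrite big1 // => z _; rewrite g1 !mul0r.
  transitivity (\sum_a \sum_j M (w a) k j * F 1%g (a, j)).
    rewrite addr0 pair_bigA; apply: eq_bigr => -[a j] _ /=.
    by rewrite eqxx mul1r.
  rewrite sumW; apply: eq_bigr => a _; apply: eq_bigr => j _; congr (_ * _).
  by rewrite (big_pred1 a) // => b /=; rewrite /w nth_uniq.
have M'r a b j (F : G -> J0 -> R) : edge a b ->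
    \sum_(g <- T0) \sum_z M' g (inr (a, b, j)) z * F g z =
    F 1%g (b, j) - F (w b / w a)%g (a, j).
  move=> ab; rewrite -[F 1%g (b, j)](big_pick (b, j) F UT0 T01).
  rewrite -[F _ (a, j)](big_pick (a, j) F UT0 (T0edge a b ab)) -sumrB.
  apply: eq_bigr => g _; rewrite -sumrB; apply: eq_bigr => z _.
  by rewrite /M' ab mul1r mulrBl.
have M'r0 a b j (F : G -> J0 -> R) : ~~ edge a b ->
    \sum_(g <- T0) \sum_z M' g (inr (a, b, j)) z * F g z = 0.
  move=> /negPf ab; rewrite big1 // => g _; rewrite big1 // => z _.
  by rewrite /M' ab !mul0r.
pose y (z : J0) x := v z.2 ((w z.1)^-1 * x)%g.
suff y0 : y = (fun _ _ => 0).
  apply/funext => j; apply/funext => x; have := congr1 (fun f => f (a1, j) x) y0.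
  by rewrite /y /= wa1 invg1 mul1g.
apply: (@linear_system R G T0 UT0 _ #|J0| K0 J0 M' erefl _ y (n%:R * C)).
- move=> s0 g0 s0T /eqP s01.
  have Ss0 : S s0 by case: (T0S _ s0T) s01 => // ->; rewrite eqxx.
  have [c cP] := free_cut freeG g0 Ss0; exists c => s g /T0S[->|]; last exact: cP.
  by rewrite mul1g [1%g == s0]eq_sym (negPf s01) andbF addbF.
- move=> r rP.
  have redge a b j : edge a b -> r (b, j) = r (a, j).
    move=> ab; have := rP (inr (a, b, j)); rewrite (M'r _ _ _ (fun _ => r)) //.
    by move=> /eqP; rewrite subr_eq0 => /eqP.
  have rconst a j : r (a, j) = r (a1, j).
    pose rho h := \sum_(b | w b == h) r (b, j).
    have rhow b : rho (w b) = r (b, j).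
      by rewrite /rho (big_pred1 b) // => b' /=; rewrite /w nth_uniq.
    rewrite -!rhow wa1; apply: conn => // s h Ss /W_w[b <-] /W_w[b' b'E].
    rewrite -b'E !rhow; apply: redge; apply/asboolP.
    by rewrite b'E mulgK.
  have r1 : forall j, r (a1, j) = 0.
    apply: Minj => k; apply: etrans (rP (inl k)); rewrite (M'l k (fun _ => r)).
    rewrite -[LHS](@big_uniq_sub _ _ T W) //; last first.
      by move=> g gT; rewrite big1 // => j _; rewrite M0 ?mul0r.
    rewrite !sumW; apply: eq_bigr => a _; apply: eq_bigr => j _; congr (_ * _).
    by rewrite (big_pred1 a) ?rconst // => b /=; rewrite /w nth_uniq.
  by move=> [a j]; rewrite rconst.
- move=> s Us; rewrite -(pair_bigA _ (fun a j => \sum_(x <- s) y (a, j) x ^+ 2)) /=.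
  rewrite mulr_natl -[n in leRHS](card_ord n) -sumr_const; apply: ler_sum => a _.
  have Ua : uniq [seq ((w a)^-1 * x)%g | x <- s] by rewrite map_inj_uniq //; exact: mulgI.
  apply: le_trans (vC _ Ua); apply: ler_sum => j _; by rewrite big_map.
apply/funext => -[k|[[a b] j]]; apply/funext => x; rewrite /convop.
  rewrite (M'l k (fun g z => y z (g^-1 * x)%g)).
  have := congr1 (fun f => f k x) Mv; rewrite /convop => E; apply: etrans E.
  rewrite -[RHS](@big_uniq_sub _ _ T W) //; last first.
    by move=> g gT; rewrite big1 // => j _; rewrite M0 ?mul0r.
  rewrite !sumW; apply: eq_bigr => a _; apply: eq_bigr => j _; congr (_ * _).
  by rewrite (big_pred1 a) ?/y /= ?invg1 ?mul1g // => b /=; rewrite /w nth_uniq.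
have [ab|ab] := boolP (edge a b); last exact: (M'r0 a b j (fun g z => y z (g^-1 * x)%g)).
rewrite (M'r a b j (fun g z => y z (g^-1 * x)%g)) // /y /= invg1 mul1g.
by rewrite invgF !mulgA mulVg mul1g subrr.
Qed.

End FreeInjective.

Section FreeEigenvalues.
Variable R : realType.
Notation C := R[i].
Notation alg := (@is_algebraic R).
Notation AEP := (@algebraic_eigenvalue_property R).

(** On constant functions [A] acts by the sums of its coefficients, a matrix
    of algebraic numbers. *)
Theorem free_aep (G : groupType) : is_free_group G -> AEP G.
Proof.
move=> [S freeG] d A Aalg lambda [v [vl2 [i0 [x0 v0]] Av]]; apply: contrapT => lam.
have [T' [UT' A0']] := group_ring_mx_supp A.
pose T := undup (1%g :: T').
have UT : uniq T by exact: undup_uniq.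
have T1 : 1%g \in T by rewrite mem_undup mem_head.
have A0 g : g \notin T -> forall i j, A i j g = 0.
  by rewrite mem_undup inE negb_or => /andP[_]; exact: A0'.
pose L := sub_coef id lambda (fun g i j => A i j g).
have Lv : convop T L v = (fun _ _ => 0).
  apply/funext => i; apply/funext => x; rewrite convop_sub_coef //.
  by rewrite -(mx_convolE _ UT A0) Av subrr.
have [K vK] := l2_l2_le vl2.
have realify_eq0 : realify v = (fun _ _ => 0).
  apply: (@free_injective R G S freeG _ _ T (real_coef L) UT _ _ _ _ vK).
  - move=> g gT [i b] [j b']; rewrite /real_coef /L /sub_coef /= A0 //.
    have -> : (g == 1%g) = false by apply: contraNF gT => /eqP ->.
    by rewrite mul0r subr0 oppr0 !if_same.
  - move=> r rP; apply: contrapT => rn0; apply: lam.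
    pose rc (i : 'I_d) (_ : G) := Complex (r (i, false)) (r (i, true)).
    have rvc : realify rc = fun ib _ => r ib by apply/funext => -[i []].
    have Lr : convop T L rc = (fun _ _ => 0).
      rewrite -[LHS](@realifyK R G) -convop_realify rvc; apply/funext => i; apply/funext => x.
      by rewrite /complexify /convop !rP.
    apply: (@alg_eigenvalue R _ (fun i j => \sum_(g <- T) A i j g) (fun i => rc i 1%g)).
    + by move=> i j; apply: alg_sum.
    + apply: contrapT => rc0; apply: rn0 => -[i b].
      have : rc i 1%g = 0 by apply: contrapT => /eqP rci; apply: rc0; exists i.
      by case: b => -[].
    + move=> i; have := congr1 (fun f => f i 1%g) Lr; rewrite convop_sub_coef // => /eqP.
      rewrite subr_eq0 => /eqP <-; rewrite /convop exchange_big; apply: eq_bigr => j _.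
      by rewrite mulr_suml.
  - by rewrite convop_realify Lv realify0.
move: v0; have /(can_inj (@realifyK R G _)) -> : realify v = realify (fun _ _ => 0) by rewrite realify_eq0 realify0.
by rewrite eqxx.
Qed.

Theorem linnell_aep (G : groupType) : linnell_class G -> AEP G.
Proof.
elim=> {G} [G|N G Q _ aepN eaQ|G I H _ aepH].
- exact: free_aep.
- exact: good_elementary_amenable eaQ _ _ aepN.
- exact: aep_directed_union aepH.
Qed.

End FreeEigenvalues.

Theorem corollary4p13 (R : realType) :
  (forall G : groupType, amenable R G -> algebraic_eigenvalue_property R G) /\
  (forall G : groupType, linnell_class G -> algebraic_eigenvalue_property R G).
Proof. by split=> G; [exact: amenable_aep | exact: linnell_aep]. Qed.
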